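(* Let $K$ be an imaginary quadratic field of discriminant $d_K$, let $\mathfrak{n}$ be a nontrivial (nonzero) ideal of $\mathcal{O}_K$ and let $N$ be the least positive integer in $\mathfrak{n}$. Let $Q=ax^2+bxy+cy^2$ and $Q'=a'x^2+b'xy+c'y^2$ be elements of $\mathcal{Q}_N(d_K)$. Take $\gamma\in\mathrm{SL}_2(\mathbb{Z})$ (one exists) such that the form $Q''=a''x^2+b''xy+c''y^2=Q'^{\,\gamma}$ satisfies $\gcd(a,\,a'',\,(b+b'')/2)=1$, and let $B$ be an integer (unique modulo $2aa''$) satisfying $$B\equiv b\pmod{2a},\quad B\equiv b''\pmod{2a''},\quad B^2\equiv d_K\pmod{4aa''}.$$ Put $$\nu_1=\frac{-B+\sqrt{d_K}}{2aa''\,j(\gamma,\,\omega_{Q''})},\qquad \nu_2=\frac{1}{j(\gamma,\,\omega_{Q''})}.$$ Then there exist $u,v\in\mathbb{Z}$ with $1=u\nu_1+v\nu_2$; for such $u,v$ one can take a matrix $\sigma\in\mathrm{SL}_2(\mathbb{Z})$ with $\sigma\equiv\begin{bmatrix}*&*\\ u&v\end{bmatrix}\pmod{NM_2(\mathbb{Z})}$, and in the group $\mathcal{Q}_N(d_K)/\sim_\mathfrak{n}$ one has $$[Q][Q']=\left[\left(aa''x^2+Bxy+\frac{B^2-d_K}{4aa''}y^2\right)^{\sigma^{-1}}\right].$$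
   Context: $\mathcal{Q}(d_K)$ is the set of primitive positive definite integral binary quadratic forms $ax^2+bxy+cy^2$ of discriminant $d_K$; $\mathcal{Q}_N(d_K)$ is the subset of those with $\gcd(N,a)=1$. For $Q=ax^2+bxy+cy^2\in\mathcal{Q}(d_K)$, $\omega_Q=\frac{-b+\sqrt{d_K}}{2a}$. For $\gamma\in\mathrm{SL}_2(\mathbb{Z})$, $Q^\gamma$ is the form $Q\left(\gamma\begin{bmatrix}x\\ y\end{bmatrix}\right)$. For a real $2\times2$ matrix $\alpha=\begin{bmatrix}p&q\\ r&s\end{bmatrix}$ of positive determinant and $\tau$ in the upper half-plane, $j(\alpha,\tau)=r\tau+s$. $[\alpha,\beta]=\mathbb{Z}\alpha+\mathbb{Z}\beta$. $\mathcal{C}(\mathfrak{n})=I_K(\mathfrak{n})/P_{K,1}(\mathfrak{n})$ is the ray class group modulo $\mathfrak{n}$, where $I_K(\mathfrak{n})$ is the group of fractional ideals relatively prime to $\mathfrak{n}$ and $P_{K,1}(\mathfrak{n})=\{\nu\mathcal{O}_K\mid\nu\in K^*,\ \nu\equiv^*1\pmod{\mathfrak{n}}\}$. For $Q,Q'\in\mathcal{Q}_N(d_K)$, $Q\sim_\mathfrak{n}Q'$ means $[[\omega_Q,1]]=[[\omega_{Q'},1]]$ in $\mathcal{C}(\mathfrak{n})$. The map $[Q]\mapsto[[\omega_Q,1]]$ is a bijection $\mathcal{Q}_N(d_K)/\sim_\mathfrak{n}\to\mathcal{C}(\mathfrak{n})$, and the group structure on $\mathcal{Q}_N(d_K)/\sim_\mathfrak{n}$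 is the one transported from $\mathcal{C}(\mathfrak{n})$ through it. *)

(* Defs.v *)
From HB Require Import structures.
From mathcomp Require Import all_boot all_order all_algebra all_field.
From mathcomp Require Import ring.
From mathcomp Require Import classical_sets.

Set Implicit Arguments.
Unset Strict Implicit.
Unset Printing Implicit Defensive.

Import Order.TTheory GRing.Theory Num.Theory.
Local Open Scope classical_set_scope.
Local Open Scope ring_scope.

(* A number field is handled as its image in the field algC of complex
   algebraic numbers; ideals and lattices are subsets of algC. *)

Definition imaginary_quadratic (K : set algC) : Prop :=
  exists (F : fieldExtType rat) (iota : {rmorphism F -> algC}),
    [/\ \dim {: F}%VS = 2%N, K = range iota
      & exists2 x, K x & x \isn't Num.real].

Definition OK (K : set algC) : set algC := [set x | K x /\ x \in Aint].

Definition lattice (alpha beta : algC) : set algC :=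
  [set x | exists m n : int, x = m%:~R * alpha + n%:~R * beta].

(* The discriminant is the square of the determinant of (s_i(w_j)) for a
   Z-basis (w_1, w_2) of OK and the two embeddings s_1, s_2 of K, which for an
   imaginary quadratic K are the identity and complex conjugation. *)
Definition field_disc (K : set algC) (d : int) : Prop :=
  exists w1 w2 : algC,
    [/\ OK K = lattice w1 w2,
        (forall m n : int,
           m%:~R * w1 + n%:~R * w2 = 0 -> m = 0 /\ n = 0)
      & d%:~R = (w1 * w2^* - w2 * w1^*) ^+ 2].

Definition OK_submodule (K A : set algC) : Prop :=
  [/\ A `<=` K, A 0, (forall x y, A x -> A y -> A (x + y))
    & forall r x, OK K r -> A x -> A (r * x)].

Definition fractional_ideal (K A : set algC) : Prop :=
  [/\ OK_submodule K A, (exists2 x, A x & x != 0)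
    & exists d, [/\ OK K d, d != 0 & forall x, A x -> OK K (d * x)]].

Definition nonzero_ideal (K A : set algC) : Prop :=
  fractional_ideal K A /\ A `<=` OK K.

Definition ideal_mul (A B : set algC) : set algC :=
  [set x | exists (k : nat) (f g : 'I_k -> algC),
     [/\ forall i, A (f i), forall i, B (g i) & x = \sum_(i < k) f i * g i]].

(* nu OK *)
Definition principal (K : set algC) (nu : algC) : set algC :=
  [set nu * x | x in OK K].

(* A + B = OK *)
Definition comaximal (A B : set algC) : Prop :=
  exists x y, [/\ A x, B y & x + y = 1].

(* I_K(n): the fractional ideals A = B C^-1 with B, C ideals prime to n *)
Definition I_K (K n : set algC) : set (set algC) :=
  [set A | fractional_ideal K A /\
     exists B C : set algC,
       [/\ nonzero_ideal K B, nonzero_ideal K C,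
           comaximal B n, comaximal C n & ideal_mul A C = B]].

(* nu =* 1 (mod n), i.e. nu = alpha / beta with alpha = beta (mod n) and beta
   prime to n; equivalently ord_p(nu - 1) >= ord_p(n) for all primes p | n. *)
Definition mcong1 (K n : set algC) (nu : algC) : Prop :=
  exists alpha beta : algC,
    [/\ OK K alpha, OK K beta & beta != 0] /\
    [/\ comaximal (principal K beta) n, n (alpha - beta)
      & nu = alpha / beta].

(* P_{K,1}(n) *)
Definition P_K1 (K n : set algC) : set (set algC) :=
  [set principal K nu | nu in [set nu | [/\ K nu, nu != 0 & mcong1 K n nu]]].

(* The class of A in C(n) = I_K(n) / P_{K,1}(n), as a coset; the group law is
   the product of cosets. *)
Definition ray_class (K n A : set algC) : set (set algC) :=
  [set C | I_K K n C /\ exists2 P, P_K1 K n P & C = ideal_mul A P].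

Definition ray_mul (X Y : set (set algC)) : set (set algC) :=
  [set ideal_mul A B | A in X & B in Y].

Record bqf : Type := BQF { qa : int; qb : int; qc : int }.

Definition bqf_eval (Q : bqf) (x y : int) : int :=
  qa Q * x ^+ 2 + qb Q * x * y + qc Q * y ^+ 2.

Definition bqf_disc (Q : bqf) : int := qb Q ^+ 2 - 4 * qa Q * qc Q.

Definition primitive (Q : bqf) : Prop := gcdz (gcdz (qa Q) (qb Q)) (qc Q) = 1.

Definition posdef (Q : bqf) : Prop :=
  forall x y : int, (x != 0) || (y != 0) -> 0 < bqf_eval Q x y.

(* Q^g, the form Q(g (x,y)^T); see bqf_act_eval. *)
Definition bqf_act (Q : bqf) (g : 'M[int]_2) : bqf :=
  let p := g 0 0 in let q := g 0 1 in let r := g 1 0 in let s := g 1 1 in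
  BQF (qa Q * p ^+ 2 + qb Q * p * r + qc Q * r ^+ 2)
      (2 * qa Q * p * q + qb Q * (p * s + q * r) + 2 * qc Q * r * s)
      (qa Q * q ^+ 2 + qb Q * q * s + qc Q * s ^+ 2).

Lemma bqf_act_eval (Q : bqf) (g : 'M[int]_2) (x y : int) :
  bqf_eval (bqf_act Q g) x y =
  bqf_eval Q (g 0 0 * x + g 0 1 * y) (g 1 0 * x + g 1 1 * y).
Proof. by rewrite /bqf_eval /bqf_act /=; ring. Qed.

Definition Qforms (d : int) : set bqf :=
  [set Q | [/\ primitive Q, posdef Q & bqf_disc Q = d]].

Definition QNforms (N : nat) (d : int) : set bqf :=
  [set Q | Qforms d Q /\ coprimez N (qa Q)].

(* For d < 0, sqrtC d%:~R is the square root of d in the upper half-plane. *)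
Definition sqrtd (d : int) : algC := sqrtC d%:~R.

Definition omega (d : int) (Q : bqf) : algC :=
  (- (qb Q)%:~R + sqrtd d) / (2 * (qa Q)%:~R).

Definition jfac (g : 'M[int]_2) (tau : algC) : algC :=
  (g 1 0)%:~R * tau + (g 1 1)%:~R.

Definition form_ray_class (K n : set algC) (d : int) (Q : bqf) :
    set (set algC) :=
  ray_class K n (lattice (omega d Q) 1).

(* Q ~_n Q' *)
Definition form_equiv (K n : set algC) (d : int) (Q Q' : bqf) : Prop :=
  form_ray_class K n d Q = form_ray_class K n d Q'.

(* The class of Q in Q_N(d) / ~_n *)
Definition form_class (K n : set algC) (N : nat) (d : int) (Q : bqf) :
    set bqf :=
  [set R | QNforms N d R /\ form_equiv K n d Q R].

(* The product of two classes X, Y of Q_N(d) / ~_n, transported from C(n):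
   the class formed by the R in Q_N(d) with
   [[omega_R, 1]] = [[omega_Q, 1]] [[omega_Q', 1]] for Q in X and Q' in Y. *)
Definition form_class_mul (K n : set algC) (N : nat) (d : int)
    (X Y : set bqf) : set bqf :=
  [set R | QNforms N d R /\
     exists Q Q', [/\ X Q, Y Q' &
       form_ray_class K n d R =
       ray_mul (form_ray_class K n d Q) (form_ray_class K n d Q')]].

Definition least_pos_int (n : set algC) (N : nat) : Prop :=
  [/\ (0 < N)%N, n N%:R
    & forall m : nat, (0 < m)%N -> n m%:R -> (N <= m)%N].

(* gcd(a, a'', (b + b'')/2) = 1; b + b'' is even for forms of the same
   discriminant. *)
Definition concordant_gcd (Q Q'' : bqf) : Prop :=
  gcdz (gcdz (qa Q) (qa Q'')) ((qb Q + qb Q'') %/ 2)%Z = 1.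

Definition compose_B (d : int) (Q Q'' : bqf) (B : int) : Prop :=
  [/\ (B = qb Q %[mod 2 * qa Q])%Z, (B = qb Q'' %[mod 2 * qa Q''])%Z
    & (B ^+ 2 = d %[mod 4 * qa Q * qa Q''])%Z].

(* The division is exact when B satisfies compose_B. *)
Definition compose_form (d : int) (Q Q'' : bqf) (B : int) : bqf :=
  BQF (qa Q * qa Q'') B ((B ^+ 2 - d) %/ (4 * qa Q * qa Q''))%Z.

(* Main.v *)
(* Write w for the root of the composed form, so that j := j(gamma, w_Q'') is
   u w + v.  Since [w_Q', 1] = j^-1 [w_Q'', 1], while w_Q = a'' w and
   w_Q'' = a w up to integers, Dirichlet composition reads
     [w_Q, 1] [w_Q', 1] = j^-1 [w, 1] = (j(sigma, w) / j) [w_R, 1].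
   Now j itself need not be prime to n, but a a' j^-1 [w, 1] lies in O_K, so
     that
   a a' j(sigma, w) / j is congruent to a a' modulo N O_K;
     as a a' is prime to N,
   j(sigma, w) / j =* 1 mod n.  The first coefficient of R is congruent to a a'
   modulo N because the composed form takes the value a a'' N(j) = a a' at
   (v, -u). *)
Require Import Defs.
From mathcomp Require Import all_boot all_order all_algebra all_field.
From mathcomp Require Import zify ring.
From mathcomp Require Import classical_sets.

Set Implicit Arguments.
Unset Strict Implicit.
Unset Printing Implicit Defensive.

Import Order.TTheory GRing.Theory Num.Theory.
Local Open Scope ring_scope.

(** * Binary quadratic forms and unimodular matrices *)

(** Two obstacles shape the argument. First, gamma only arranges concordance, so a'' may share
    factors with N; as N(j) = a'/a'', this is why j can fail to be prime to n and why the
    denominators are cleared with a a', which is prime to N. Second, (u, v) is forced: u = r a and v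
    = s + r l, where (r, s) is the bottom row of gamma and B = b'' + 2 a'' l. These two integers
    need not be coprime: for (2, 1, 3) and (2, -1, 3), with gamma exchanging the variables up to a
    sign and B = 1, one finds (2, 0). Only gcd(u, v, N) = 1 holds, so sigma can match (u, v) only
    modulo N, and the ratio j(sigma, w) / j need not be a unit; it is absorbed by P_{K,1}(n). All
    coprimality, for integers and for ideals, is carried by Bezout relations; no factorization into
    prime ideals occurs. *)

Lemma eqz_modP (m x y : int) :
  (x = y %[mod m])%Z <-> exists k, x = y + k * m.
Proof.
split=> [/eqP | [k ->]]; last by rewrite addrC modzMDl.
by rewrite eqz_mod_dvd => /dvdzP[k Dk]; exists k; lia.
Qed.

Lemma gcdz3_eq1P (a b c : int) :
  gcdz (gcdz a b) c = 1 <-> exists x y z : int, x * a + y * b + z * c = 1.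
Proof.
split=> [g1 | [x [y [z e1]]]].
  have [u [v Dab]] := Bezoutz a b; have [w [z]] := Bezoutz (gcdz a b) c.
  rewrite g1 -Dab => e1; exists (w * u), (w * v), z.
  by rewrite -e1; ring.
have gl := dvdz_gcdl (gcdz a b) c; have gc := dvdz_gcdr (gcdz a b) c.
have ga := dvdz_trans gl (dvdz_gcdl a b).
have gb := dvdz_trans gl (dvdz_gcdr a b).
have: (gcdz (gcdz a b) c %| 1%R)%Z by rewrite -e1 !rpredD ?dvdz_mull.
by rewrite dvdz1 => /eqP g1; rewrite -[LHS]/(`|gcdz (gcdz a b) c|%N%:Z) g1.
Qed.

(** Prescribing which primes of M divide an integer takes the place of Chinese remaindering when a
    coprimality is arranged prime by prime. *)
Lemma prime_divisors_product (M : nat) (P : pred nat) : (0 < M)%N ->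
  exists y : nat, (0 < y)%N /\
    forall p, prime p -> (p %| y)%N = (p %| M)%N && P p.
Proof.
move=> M0; exists (\prod_(p <- primes M | P p) p)%N; split.
  rewrite big_seq_cond; apply: prodn_cond_gt0 => p.
  by rewrite mem_primes => /andP[/and3P[/prime_gt0]].
move=> p pr_p; rewrite Euclid_dvd_prod // big_has_cond.
apply/hasP/andP => [[q /=] | [pM Pp]].
  rewrite mem_primes => /and3P[pr_q _ qM] /andP[Pq].
  by rewrite dvdn_prime2 // => /eqP->.
by exists p; [rewrite mem_primes pr_p M0 | rewrite /= Pp dvdnn].
Qed.

Lemma coprimez_prime (m n : int) :
  (forall p : nat, prime p -> (p %| m)%Z -> (p %| n)%Z -> False) ->
  coprimez m n.
Proof.
move=> noP; rewrite coprimezE; apply/negPn/negP.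
rewrite /coprime neq_ltn ltnS leqn0 => /orP[g0 | /pdivP[p pr_p]].
  move: g0; rewrite eqn0Ngt gcdn_gt0 negb_or -!eqn0Ngt !absz_eq0.
  (* A zero gcd means m = n = 0, and then any prime, here 2, divides both. *)
  by case/andP=> /eqP m0 /eqP n0; apply: (noP 2%N); rewrite // ?m0 ?n0 dvdz0.
by rewrite dvdn_gcd => /andP[pm pn]; apply: (noP p).
Qed.

(* A prime p | M with p not dividing a divides y but not x, one dividing a but
   not c divides x but not y, and one dividing a and c divides neither. *)
Lemma primitive_represents_coprime (Q : bqf) (M : int) :
  primitive Q -> M != 0 ->
  exists x y : int, coprimez x y /\ coprimez M (bqf_eval Q x y).
Proof.
case: Q => a b c; rewrite /primitive /= => prQ M0.
have M0' : (0 < `|M|)%N by rewrite absz_gt0.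
pose A p := (p %| `|a|)%N; pose C p := (p %| `|c|)%N.
have [y [_ yP]] := prime_divisors_product (predC A) M0'.
have [x [_ xP]] := prime_divisors_product [pred p | A p && ~~ C p] M0'.
exists x%:Z, y%:Z; split.
  apply: coprimez_prime => p pr_p; rewrite !dvdzE /= xP // yP //=.
  by case/and3P=> _ -> _; rewrite andbF.
apply: coprimez_prime => p pr_p pM; rewrite /bqf_eval /=.
move: (xP p pr_p) (yP p pr_p); rewrite (pM : (p %| `|M|)%N) /= => xp yp.
have Mp (m n : int) : (p %| m * n)%Z = (p %| m)%Z || (p %| n)%Z.
  by rewrite !dvdzE abszM Euclid_dvdM.
have Dl (m n : int) : (p %| m)%Z -> (p %| m + n)%Z = (p %| n)%Z by exact:
  rpredDl.
have Dr (m n : int) : (p %| n)%Z -> (p %| m + n)%Z = (p %| m)%Z by exact: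
  rpredDr.
have xpZ : (p %| x%:Z)%Z = A p && ~~ C p by [].
have ypZ : (p %| y%:Z)%Z = ~~ A p by [].
have apZ : (p %| a)%Z = A p by [].
have cpZ : (p %| c)%Z = C p by [].
case: (boolP (A p)) => Ap in xpZ ypZ apZ *; last first.
  by rewrite Dr ?Dr ?expr2 !Mp ?ypZ ?orbT // xpZ apZ.
case: (boolP (C p)) => Cp in xpZ cpZ *; last first.
  by rewrite -addrA Dl ?Dl ?expr2 !Mp ?xpZ ?orbT // ypZ cpZ.
(* Here p divides a and c but neither x nor y, so the value is b x y modulo p; if p divided it, p
   would divide b, against primitivity. *)
rewrite Dr ?Mp ?cpZ // Dl ?Mp ?apZ //.
rewrite !(Mp, xpZ, ypZ) /= !orbF => bpZ.
have [u [v [w]]] := (gcdz3_eq1P a b c).1 prQ.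
move/(congr1 (fun t => p %| t)%Z); rewrite !rpredD ?dvdz_mull ?apZ ?cpZ // =>
  /esym.
by rewrite dvdz1 => /eqP /= p1; rewrite p1 in pr_p.
Qed.

(** * Unimodular matrices and their action on forms *)

Definition mx2 (p q r s : int) : 'M[int]_2 :=
  \matrix_(i, j) (if i == 0 then if j == 0 then p else q
                  else if j == 0 then r else s).

Lemma det_mx2 (g : 'M[int]_2) : \det g = g 0 0 * g 1 1 - g 0 1 * g 1 0.
Proof.
rewrite (expand_det_row _ 0) !big_ord_recl big_ord0 /cofactor !det_mx11 !mxE /=.
rewrite /bump /= !expr0 !expr1 mul1r mulN1r addr0 mulrN; congr (_ * _ - _ * _).
all: by congr (g _ _); apply: val_inj.
Qed.

Lemma invmx_mx2 (g : 'M[int]_2) : \det g = 1 ->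
  invmx g = mx2 (g 1 1) (- g 0 1) (- g 1 0) (g 0 0).
Proof.
move=> g1; have gU : g \in unitmx by rewrite unitmxE g1 unitr1.
rewrite -[RHS](mulKmx gU) (_ : g *m _ = 1%:M) ?mulmx1 //.
rewrite det_mx2 in g1; apply/matrixP=> i j.
rewrite !mxE !big_ord_recl big_ord0 !mxE addr0 (_ : lift ord0 ord0 = 1 :>
  'I_2); last first.
  exact: val_inj.
have ord2P (k : 'I_2) : k = 0 \/ k = 1.
  by case: k => [[|[|//]] ?]; [left | right]; apply: val_inj.
case: (ord2P i) => ->; case: (ord2P j) => -> /=.
- by rewrite -g1; ring.
- by rewrite mulrN mulrC addNr.
- by rewrite mulrN mulrC addrN.
- by rewrite -g1; ring.
Qed.

(* Replacing u = 0 by N, one adds to v the multiple k * N, where k is the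
   product of the primes dividing u but not v. *)
Lemma lift_bottom_row (N : nat) (u v : int) : (0 < N)%N ->
  gcdz (gcdz u v) N = 1 ->
  exists g : 'M[int]_2, [/\ \det g = 1, (g 1%R 0%R = u %[mod N])%Z
                & (g 1%R 1%R = v %[mod N])%Z].
Proof.
move=> N0 cuvN.
have [u' [u'0 u'N cop]] : exists u' : int,
    [/\ u' != 0, (u' = u %[mod N])%Z & gcdz (gcdz u' v) N = 1].
  have [u0|u0] := eqVneq u 0; last by exists u.
  exists N%:Z; split; first by rewrite eqz_nat -lt0n.
    by apply/eqz_modP; exists 1; rewrite u0; lia.
  apply/gcdz3_eq1P; have [x [y [z e]]] := (gcdz3_eq1P _ _ _).1 cuvN.
  by exists 0, y, z; rewrite -e u0; ring.
have u'0' : (0 < `|u'|)%N by rewrite absz_gt0.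
have [k [_ kP]] := prime_divisors_product [pred p | ~~ (p %| `|v|)%N] u'0'.
pose v' := v + k%:Z * N.
have /coprimezP[[s q] /= e] : coprimez u' v'.
  apply: coprimez_prime => p pr_p pu pv'.
  have := kP p pr_p; rewrite (pu : (p %| `|u'|)%N) /= => kp.
  have kpZ : (p %| k%:Z)%Z = ~~ (p %| v)%Z by [].
  (* A prime p of u' divides exactly one of v and k. If p also divides v + k N, it must divide v,
     hence not k, hence N, against [cop]. *)
  have [pv | npv] := boolP (p %| v)%Z; rewrite ?pv ?npv in kpZ.
    move: pv'; rewrite /v' rpredDl // => pkN.
    have {pkN} pN : (p %| N%:Z)%Z.
      by move: pkN; rewrite !dvdzE abszM Euclid_dvdM // [(_ %| `|k%:Z|)%N]kpZ.
    have [x [y [z]]] := (gcdz3_eq1P _ _ _).1 cop.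
    move/(congr1 (fun t => p %| t)%Z); rewrite !rpredD ?dvdz_mull // => /esym.
    by rewrite dvdz1 => /eqP /= p1; rewrite p1 in pr_p.
  by move: pv'; rewrite /v' rpredDr ?dvdz_mulr ?kpZ //; apply/negP.
exists (mx2 q (- s) u' v'); rewrite det_mx2 !mxE /=; split=> //.
  by rewrite -e; ring.
by apply/eqz_modP; exists k%:Z.
Qed.

Lemma qa_gt0 (Q : bqf) : posdef Q -> 0 < qa Q.
Proof. by move/(_ 1 0 isT); rewrite /bqf_eval expr0n expr1n !mulr0 !addr0
  mulr1. Qed.

Lemma posdef_disc_lt0 (Q : bqf) : posdef Q -> bqf_disc Q < 0.
Proof.
move=> pdQ; have a0 := qa_gt0 pdQ.
(* This vector kills the square 2a x + b y in 4a Q(x, y) = (2a x + b y)^2 - D y^2. *)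
have := pdQ (- qb Q) (2 * qa Q); rewrite mulf_eq0 (gt_eqF a0) orbT => /(_ isT).
rewrite [bqf_eval _ _ _](_ : _ = qa Q * - bqf_disc Q); last first.
  by rewrite /bqf_eval /bqf_disc; ring.
by rewrite pmulr_rgt0 // oppr_gt0.
Qed.

Lemma disc_lt0_posdef (Q : bqf) : 0 < qa Q -> bqf_disc Q < 0 -> posdef Q.
Proof.
move=> a0 d0 x y xy0; rewrite -(pmulr_rgt0 _ a0) -(@pmulr_rgt0 _ 4) //.
rewrite (_ : 4 * _ = (2 * qa Q * x + qb Q * y) ^+ 2 + - bqf_disc Q * y ^+ 2);
  last first.
  by rewrite /bqf_eval /bqf_disc; ring.
have [y0 | y0] := eqVneq y 0.
  move: xy0; rewrite y0 eqxx orbF expr0n !mulr0 !addr0 => x0.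
  by rewrite exprn_even_gt0 //= !mulf_neq0 // gt_eqF.
by rewrite ltr_wpDl ?sqr_ge0 // mulr_gt0 ?oppr_gt0 // exprn_even_gt0.
Qed.

Lemma bqf_disc_act (Q : bqf) (g : 'M[int]_2) :
  bqf_disc (bqf_act Q g) = bqf_disc Q * (\det g) ^+ 2.
Proof. by rewrite det_mx2 /bqf_disc /=; ring. Qed.

Lemma bqf_actK (Q : bqf) (g : 'M[int]_2) : \det g = 1 ->
  bqf_act (bqf_act Q g) (invmx g) = Q.
Proof.
case: Q => a b c g1; rewrite invmx_mx2 //; rewrite det_mx2 in g1.
(* Acting by g and then by its adjugate multiplies Q by det(g)^2 identically, so inserting this
   factor on the right leaves a polynomial identity. *)
have g2 : (g 0 0 * g 1 1 - g 0 1 * g 1 0) ^+ 2 = 1 by rewrite g1.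
rewrite /bqf_act !mxE /=; congr BQF.
all: by rewrite -[RHS]mulr1 -[X in _ = _ * X]g2; ring.
Qed.

Lemma det_invmx1 (g : 'M[int]_2) : \det g = 1 -> \det (invmx g) = 1.
Proof. by move=> g1; rewrite det_inv g1 invr1. Qed.

Lemma bqf_actVK (Q : bqf) (g : 'M[int]_2) : \det g = 1 ->
  bqf_act (bqf_act Q (invmx g)) g = Q.
Proof. by move=> g1; rewrite -{2}[g]invmxK bqf_actK // det_invmx1. Qed.

(** The inverse matrix recovers Q from Q^g, so the coefficients of Q are integer combinations of
    those of Q^g, and a Bezout relation for the former becomes one for the latter. *)
Lemma primitive_act (Q : bqf) (g : 'M[int]_2) : \det g = 1 ->
  primitive Q -> primitive (bqf_act Q g).
Proof.
move=> g1 /gcdz3_eq1P[x [y [z]]].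
rewrite -{1 2 3}(bqf_actK Q g1); set h := invmx g; set R := bqf_act Q g.
move=> e; apply/gcdz3_eq1P.
exists (x * h 0 0 ^+ 2 + y * (2 * h 0 0 * h 0 1) + z * h 0 1 ^+ 2),
  (x * (h 0 0 * h 1 0) + y * (h 0 0 * h 1 1 + h 0 1 * h 1 0) + z * (h 0 1 * h 1
    1)),
  (x * h 1 0 ^+ 2 + y * (2 * h 1 0 * h 1 1) + z * h 1 1 ^+ 2).
by rewrite -[RHS]e /bqf_act /=; ring.
Qed.

Lemma Qforms_act (d : int) (Q : bqf) (g : 'M[int]_2) : \det g = 1 ->
  Qforms d Q -> Qforms d (bqf_act Q g).
Proof.
move=> g1 [prQ pdQ dQ]; split; first exact: primitive_act.
  move=> x y xy0; rewrite bqf_act_eval; apply: pdQ; apply: contraLR xy0.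
  rewrite !negb_or !negbK => /andP[/eqP e1 /eqP e2]; rewrite det_mx2 in g1.
  have x0 : x = 0.
    rewrite -[x]mulr1 -g1.
    rewrite (_ : x * _ = g 1 1 * (g 0 0 * x + g 0 1 * y) - g 0 1 * (g 1 0 * x +
      g 1 1 * y)); last by ring.
    by rewrite e1 e2; ring.
  have y0 : y = 0.
    rewrite -[y]mulr1 -g1.
    rewrite (_ : y * _ = g 0 0 * (g 1 0 * x + g 1 1 * y) - g 1 0 * (g 0 0 * x +
      g 0 1 * y)); last by ring.
    by rewrite e1 e2; ring.
  by rewrite x0 y0.
by rewrite bqf_disc_act g1 expr1n mulr1.
Qed.

(** This is the value of Q at (s, -r), the first column of g^-1. It involves only the bottom row (r,
    s) of g, which is what is prescribed for sigma. *)
Lemma qa_act_invmx (Q : bqf) (g : 'M[int]_2) : \det g = 1 ->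
  qa (bqf_act Q (invmx g)) =
  qa Q * g 1 1 ^+ 2 - qb Q * g 1 0 * g 1 1 + qc Q * g 1 0 ^+ 2.
Proof. by move=> g1; rewrite invmx_mx2 // /bqf_act !mxE /=; ring. Qed.

(** * Dirichlet composition *)

(** A primitive form properly represents a value coprime to a; completing the representing vector to
    a unimodular matrix makes that value a'', so already gcd(a, a'') = 1. *)
Lemma exists_concordant (d : int) (Q Q' : bqf) :
  Qforms d Q -> Qforms d Q' ->
  exists g : 'M[int]_2, \det g = 1 /\ concordant_gcd Q (bqf_act Q' g).
Proof.
move=> [_ /qa_gt0 a0 _] [prQ' _ _].
have [p [r [/coprimezP[[s q] /= e] /coprimezP[[u v] /= cop]]]] :=
  primitive_represents_coprime prQ' (negbT (gt_eqF a0)).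
exists (mx2 p (- q) r s); split; first by rewrite det_mx2 !mxE /= -[RHS]e; ring.
apply/gcdz3_eq1P; exists u, v, 0.
by rewrite -[RHS]cop /bqf_eval /bqf_act !mxE /=; ring.
Qed.

Lemma half_sum_of_same_disc (Q Q'' : bqf) : bqf_disc Q = bqf_disc Q'' ->
  2 * ((qb Q + qb Q'') %/ 2)%Z = qb Q + qb Q''.
Proof.
rewrite /bqf_disc => eD; rewrite mulrC divzK //.
have: (2 %| (qb Q + qb Q'') ^+ 2)%Z.
  rewrite (_ : _ ^+ 2 = 2 * (qb Q * qb Q'' + qb Q'' ^+ 2 + 2 * qa Q * qc Q - 2
    * qa Q'' * qc Q'')).
    exact: dvdz_mulr.
  by lia.
by rewrite !dvdzE abszX Euclid_dvdX // andbT.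
Qed.

Section Composition.

Variables (d : int) (Q Q'' : bqf).
Hypotheses (hQ : Qforms d Q) (hQ'' : Qforms d Q'').
Hypothesis cQ : concordant_gcd Q Q''.

(** With s = (b + b'')/2, the three conditions amount to linear congruences modulo 2 a a'': a B = a
    b'', a'' B = a'' b and s B = (b b'' + d)/2. The last one comes from expanding (B - b)(B - b''),
    which is divisible by 4 a a''. Combining them along x a + y a'' + z s = 1 gives the formula for
    B. *)
Lemma compose_B_exists : exists B, compose_B d Q Q'' B.
Proof.
case: hQ hQ'' => _ _ dQ [_ _ dQ''].
have s2 := half_sum_of_same_disc (etrans dQ (esym dQ'')).
move: cQ => /gcdz3_eq1P[x [y [z]]]; move: s2 dQ dQ''; rewrite /bqf_disc.
set s := (_ %/ _)%Z; rewrite /compose_B.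
case: Q => a b c; case: Q'' => e f g /= s2 dQ dQ'' xyz.
have Db : b = 2 * s - f by rewrite s2; ring.
(* Both sides are (b f + d)/2, written without a division; this common value is the h below. *)
have hh : b * s - 2 * a * c = f * s - 2 * e * g.
  by apply: (mulfI (x := 2)) => //; rewrite Db in dQ *; lia.
pose h := b * s - 2 * a * c.
pose k := x * (s - b) - z * c; pose l := y * (s - f) - z * g.
pose B := x * a * f + y * e * b + z * h.
have B1 : B = b + k * (2 * a).
  have -> : b + k * (2 * a) = b * (x * a + y * e + z * s) + k * (2 * a).
    by rewrite xyz mulr1.
  by rewrite /B /h /k Db; ring.
have B2 : B = f + l * (2 * e).
  have -> : f + l * (2 * e) = f * (x * a + y * e + z * s) + l * (2 * e).
    by rewrite xyz mulr1.
  by rewrite /B /h hh /l Db; ring.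
exists B; split; apply/eqz_modP; [by exists k | by exists l |].
exists (k * l + x * g + y * c).
have sB : s * B - h = 2 * a * e * (x * g + y * c).
  have -> : s * B - h = s * B - h * (x * a + y * e + z * s) by rewrite xyz
    mulr1.
  rewrite /B (_ : _ - _ = x * a * (f * s - h) + y * e * (b * s - h));
    last by ring.
  by rewrite {1}/h hh /h; ring.
have -> : B ^+ 2 = (B - b) * (B - f) + 2 * (s * B - h) + d.
  rewrite -dQ /h Db; ring.
by rewrite {1}B1 {1}B2 sB; ring.
Qed.

(** Half the difference, t, of two solutions is annihilated modulo a a'' by a, by a'' and by s = (b
    + b'')/2, hence by the 1 that they generate. *)
Lemma compose_B_unique (B B' : int) :
  compose_B d Q Q'' B -> compose_B d Q Q'' B' ->
  (B = B' %[mod 2 * qa Q * qa Q''])%Z.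
Proof.
case: hQ hQ'' => _ /qa_gt0 + dQ [_ /qa_gt0 + dQ''].
have s2 := half_sum_of_same_disc (etrans dQ (esym dQ'')).
move: cQ => /gcdz3_eq1P[x [y [z]]]; move: s2; rewrite /compose_B.
set s := (_ %/ _)%Z.
case: Q => a b c; case: Q'' => e f g /= s2 xyz a0 e0.
move=> [/eqz_modP[k B1] /eqz_modP[l B2] /eqz_modP[m B3]].
move=> [/eqz_modP[k' B1'] /eqz_modP[l' B2'] /eqz_modP[m' B3']].
apply/eqz_modP.
pose t := a * (k - k').
have tE : t = e * (l - l') by rewrite /t; lia.
have DB : B = B' + 2 * t by rewrite /t B1 B1'; ring.
have tB : t * (B' + t) = a * e * (m - m').
  apply: (mulfI (x := 4)) => //.
  rewrite (_ : 4 * _ = (B' + 2 * t) ^+ 2 - B' ^+ 2); last by ring.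
  by rewrite -DB B3 B3'; ring.
have sE : s = B' - a * k' - e * l' by lia.
exists (x * (l - l') + y * (k - k')
        + z * ((m - m') - (k - k') * (l - l') - (l - l') * k' - (k - k') * l')).
rewrite DB; congr (_ + _).
have -> : t = t * (x * a + y * e + z * s) by rewrite xyz mulr1.
rewrite sE (_ : t * _ = x * (t * a) + y * (t * e)
   + z * (t * (B' + t) - t * t - t * a * k' - t * e * l')); last by ring.
by rewrite tB {1 3 5}tE /t; ring.
Qed.

Variable B : int.
Hypothesis hB : compose_B d Q Q'' B.

Lemma compose_formE : 4 * qa Q * qa Q'' * qc (compose_form d Q Q'' B) = B ^+ 2
  - d.
Proof.
case: hB => _ _ /eqP; rewrite eqz_mod_dvd => dv.
by rewrite /= mulrC divzK.
Qed.

(** Q(x, y) = F(x - k y, y) for F = (a, B, a'' C), where C is the last coefficient of the composed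
    form; the discriminant then determines c. In the same way Q'' is a translate of (a'', B, a
    C). *)
Lemma compose_qcl (k : int) : B = qb Q + k * (2 * qa Q) ->
  qc Q = qa Q'' * qc (compose_form d Q Q'' B) - qb Q * k - qa Q * k ^+ 2.
Proof.
move=> B1; have eC := compose_formE; case: hQ => _ /qa_gt0 a0 dQ.
apply: (@mulfI _ (4 * qa Q)); first by rewrite mulf_neq0 // gt_eqF.
rewrite [LHS](_ : _ = qb Q ^+ 2 - d); last by rewrite -dQ /bqf_disc; ring.
rewrite [RHS](_ : _ = 4 * qa Q * qa Q'' * qc (compose_form d Q Q'' B)
  - 4 * qa Q * (qb Q * k + qa Q * k ^+ 2)); last by ring.
by rewrite eC B1; ring.
Qed.

Lemma compose_qcr (l : int) : B = qb Q'' + l * (2 * qa Q'') ->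
  qc Q'' = qa Q * qc (compose_form d Q Q'' B) - qb Q'' * l - qa Q'' * l ^+ 2.
Proof.
move=> B2; have eC := compose_formE; case: hQ'' => _ /qa_gt0 e0 dQ''.
apply: (@mulfI _ (4 * qa Q'')); first by rewrite mulf_neq0 // gt_eqF.
rewrite [LHS](_ : _ = qb Q'' ^+ 2 - d); last by rewrite -dQ'' /bqf_disc; ring.
rewrite [RHS](_ : _ = 4 * qa Q * qa Q'' * qc (compose_form d Q Q'' B)
  - 4 * qa Q'' * (qb Q'' * l + qa Q'' * l ^+ 2)); last by ring.
by rewrite eC B2; ring.
Qed.

(** (b + b'')/2 is congruent to B modulo the ideal (a, a''), so concordance passes to B; this is the
    relation that makes the product of the two lattices as large as possible. *)
Lemma compose_B_coprime : exists x y z, x * qa Q + y * qa Q'' + z * B = 1.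
Proof.
case: hQ hQ'' => _ _ dQ [_ _ dQ''].
have s2 := half_sum_of_same_disc (etrans dQ (esym dQ'')).
have /gcdz3_eq1P[x [y [z]]] := cQ; move: s2; set s := (_ %/ _)%Z => s2 e1.
case: hB => /eqz_modP[k B1] /eqz_modP[l B2] _.
exists (x - z * k), (y - z * l), z; rewrite -[RHS]e1.
have -> : s = B - qa Q * k - qa Q'' * l by lia.
by ring.
Qed.

Lemma Qforms_compose : Qforms d (compose_form d Q Q'' B).
Proof.
have dC : bqf_disc (compose_form d Q Q'' B) = d.
  rewrite /bqf_disc (_ : _ * _ = 4 * qa Q * qa Q'' * qc (compose_form d Q Q''
    B)).
    by rewrite compose_formE /=; ring.
  by rewrite /=; ring.
case: hQ hQ'' => prQ pdQ dQ [prQ'' pdQ'' dQ''].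
have [a0 e0] := (qa_gt0 pdQ, qa_gt0 pdQ'').
split=> //; last first.
  by apply: disc_lt0_posdef; rewrite ?dC -?dQ ?posdef_disc_lt0 //= mulr_gt0.
apply/gcdz3_eq1P; rewrite [qa _]/= [qb _]/=; set C := qc (compose_form _ _ _ _).
case: hB => /eqz_modP[k B1] /eqz_modP[l B2] _.
have /gcdz3_eq1P[x [y [z e1]]] := prQ; have /gcdz3_eq1P[x' [y' [z' e2]]] :=
  prQ''.
have Dc := compose_qcl B1; have Dg := compose_qcr B2.
have Db : qb Q = B - k * (2 * qa Q) by rewrite B1; ring.
have Df : qb Q'' = B - l * (2 * qa Q'') by rewrite B2; ring.
pose X := x - 2 * y * k + z * k ^+ 2; pose Y := y - z * k.
pose X' := x' - 2 * y' * l + z' * l ^+ 2; pose Y' := y' - z' * l.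
(* Translating back, X a + Y B + z a'' C = 1 and X' a'' + Y' B + z' a C = 1. In their product every
   term contains a a'', B or C, which yields the Bezout relation for the composed form. *)
pose U := X' * qa Q'' + Y' * B + z' * qa Q * C.
have U1 : U = 1 by rewrite -[RHS]e2 /U /X' /Y' Dg Df -/C; ring.
exists (X * X'), (Y * U + Y' * (X * qa Q + z * qa Q'' * C)),
  (z * qa Q'' * (X' * qa Q'' + z' * qa Q * C) + z' * qa Q * (X * qa Q)).
rewrite -[RHS]mulr1 -[X in _ = _ * X]U1 -[X in _ = X * _]e1 Dc Db -/C.
by rewrite /U /X /Y; ring.
Qed.

End Composition.

(** * Ray classes *)

Local Open Scope classical_set_scope.

(** With lists of pairs in place of indexed families, adding two elements of a product is a
    concatenation. *)
Lemma ideal_mulP (A B : set algC) (x : algC) :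
  ideal_mul A B x <-> exists s : seq (algC * algC),
    (forall p, p \in s -> A p.1 /\ B p.2) /\ x = \sum_(p <- s) p.1 * p.2.
Proof.
split=> [[k [f [g [Af Bg ->]]]] | [s [sP ->]]].
  exists [seq (f i, g i) | i <- enum 'I_k]; split.
    by move=> p /mapP[i _ ->]; split; [exact: Af | exact: Bg].
  by rewrite big_map big_enum.
exists (size s), (fun i => (s`_i).1), (fun i => (s`_i).2); split.
- by move=> i; case: (sP s`_i (mem_nth _ _)).
- by move=> i; case: (sP s`_i (mem_nth _ _)).
- by rewrite (big_nth 0) big_mkord.
Qed.

Lemma ideal_mul_mem (A B : set algC) (x y : algC) : A x -> B y -> ideal_mul A B
  (x * y).
Proof.
move=> Ax By; apply/ideal_mulP; exists [:: (x, y)]; rewrite big_seq1;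
  split=> // p.
by rewrite inE => /eqP->.
Qed.

Lemma ideal_mul0 (A B : set algC) : ideal_mul A B 0.
Proof. by apply/ideal_mulP; exists [::]; rewrite big_nil. Qed.

Lemma ideal_mulD (A B : set algC) (x y : algC) :
  ideal_mul A B x -> ideal_mul A B y -> ideal_mul A B (x + y).
Proof.
move=> /ideal_mulP[s [sP ->]] /ideal_mulP[t [tP ->]]; apply/ideal_mulP.
exists (s ++ t); rewrite big_cat; split=> // p.
by rewrite mem_cat => /orP[/sP | /tP].
Qed.

Lemma ideal_mul_ind (A B C : set algC) :
  C 0 -> (forall x y, C x -> C y -> C (x + y)) ->
  (forall x y, A x -> B y -> C (x * y)) -> ideal_mul A B `<=` C.
Proof.
move=> C0 CD CM _ [k [f [g [Af Bg ->]]]].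
by elim/big_ind: _ => // i _; apply: CM.
Qed.

Lemma ideal_mulC (A B : set algC) : ideal_mul A B = ideal_mul B A.
Proof.
have sub X Y : ideal_mul X Y `<=` ideal_mul Y X.
  apply: ideal_mul_ind => [||x y Xx Yy]; [exact: ideal_mul0 | exact: ideal_mulD
    |].
  by rewrite mulrC; apply: ideal_mul_mem.
by rewrite eqEsubset.
Qed.

Lemma ideal_mulA (A B C : set algC) :
  ideal_mul A (ideal_mul B C) = ideal_mul (ideal_mul A B) C.
Proof.
have sub X Y Z : ideal_mul X (ideal_mul Y Z) `<=` ideal_mul (ideal_mul X Y) Z.
  apply: ideal_mul_ind => [||x y Xx]; [exact: ideal_mul0 | exact: ideal_mulD |].
  apply: (ideal_mul_ind (C := fun y => ideal_mul (ideal_mul X Y) Z (x * y))).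
  - by rewrite mulr0; apply: ideal_mul0.
  - by move=> u v; rewrite mulrDr; apply: ideal_mulD.
  - by move=> u v Yu Zv; rewrite mulrA; apply: ideal_mul_mem => //;
    apply: ideal_mul_mem.
rewrite eqEsubset; split; first exact: sub.
rewrite [ideal_mul _ C]ideal_mulC [ideal_mul A B]ideal_mulC.
by rewrite [ideal_mul A _]ideal_mulC [ideal_mul B C]ideal_mulC; apply: sub.
Qed.

Lemma ideal_mulACA (A B C D : set algC) :
  ideal_mul (ideal_mul A B) (ideal_mul C D) =
  ideal_mul (ideal_mul A C) (ideal_mul B D).
Proof.
by rewrite !ideal_mulA -[ideal_mul (ideal_mul A B) C]ideal_mulA [ideal_mul B
  C]ideal_mulC ideal_mulA.
Qed.

(** The closure properties on which the ideal theory rests; degree two enters through the Z-basis in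
    [field_disc]. *)
Definition subfield_set (K : set algC) : Prop :=
  [/\ K 1, (forall x y, K x -> K y -> K (x - y)),
      (forall x y, K x -> K y -> K (x * y)) & (forall x, K x -> K x^-1)].

Lemma imaginary_quadratic_subfield (K : set algC) :
  imaginary_quadratic K -> subfield_set K.
Proof.
move=> [F [iota [_ -> _]]]; split.
- by exists 1; rewrite ?rmorph1.
- by move=> _ _ [x _ <-] [y _ <-]; exists (x - y); rewrite ?rmorphB.
- by move=> _ _ [x _ <-] [y _ <-]; exists (x * y); rewrite ?rmorphM.
- by move=> _ [x _ <-]; exists x^-1; rewrite ?fmorphV.
Qed.

Section RayClasses.

Variable K : set algC.
Hypothesis subK : subfield_set K.

Lemma subfield_set0 : K 0.
Proof. by case: subK => K1 KB _ _; rewrite -(subrr 1); apply: KB. Qed.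

Lemma subfield_setD x y : K x -> K y -> K (x + y).
Proof.
case: subK => _ KB _ _ Kx Ky; rewrite -[y]opprK -[- y]sub0r.
by apply: (KB) => //; apply: KB => //; apply: subfield_set0.
Qed.

Lemma subfield_setM x y : K x -> K y -> K (x * y).
Proof. by case: subK => _ _ + _; apply. Qed.

Lemma subfield_setV x : K x -> K x^-1.
Proof. by case: subK => _ _ _; apply. Qed.

Lemma OK1 : OK K 1.
Proof. by case: subK => K1 _ _ _; split=> //; apply: rpred1. Qed.

Lemma OKB x y : OK K x -> OK K y -> OK K (x - y).
Proof. by case: subK => _ KB _ _ [Kx Ax] [Ky Ay]; split;
  [apply: KB | apply: rpredB]. Qed.

Lemma OKM x y : OK K x -> OK K y -> OK K (x * y).
Proof. by move=> [Kx Ax] [Ky Ay]; split; [apply: subfield_setM | apply: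
  rpredM]. Qed.

Lemma OK0 : OK K 0.
Proof. by rewrite -(subrr 1); apply: OKB; apply: OK1. Qed.

Lemma OKD x y : OK K x -> OK K y -> OK K (x + y).
Proof. by move=> [Kx Ax] [Ky Ay]; split; [apply: subfield_setD | apply:
  rpredD]. Qed.

Lemma OK_int (m : int) : OK K m%:~R.
Proof.
have OKn (k : nat) : OK K k%:R.
  by elim: k => [|k IHk]; rewrite ?mulrSr; [apply: OK0 | apply: OKD => //;
    apply: OK1].
case: m => k; first exact: OKn.
by rewrite NegzE rmorphN -sub0r; apply: OKB; [apply: OK0 | apply: OKn].
Qed.

Lemma subfield_set_int (m : int) : K m%:~R.
Proof. by case: (OK_int m). Qed.

Lemma fractional_ideal_mul (A B : set algC) :
  fractional_ideal K A -> fractional_ideal K B -> fractional_ideal K (ideal_mul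
    A B).
Proof.
move=> [[AK A0 AD AM] [x Ax x0] [d [OKd d0 Ad]]].
move=> [[BK B0 BD BM] [y By y0] [e [OKe e0 Be]]]; split; first split.
- by apply: ideal_mul_ind => [|u v|u v /AK Ku /BK Kv];
  [exact: subfield_set0 | exact: subfield_setD | exact: subfield_setM].
- exact: ideal_mul0.
- exact: ideal_mulD.
- move=> r x' OKr.
  apply: (ideal_mul_ind (C := fun t => ideal_mul A B (r * t))).
  + by rewrite mulr0; apply: ideal_mul0.
  + by move=> u v; rewrite mulrDr; apply: ideal_mulD.
  + by move=> u v Au Bv; rewrite mulrA; apply: ideal_mul_mem => //; apply: AM.
- by exists (x * y); [apply: ideal_mul_mem | apply: mulf_neq0].
- exists (d * e); split; [exact: OKM | exact: mulf_neq0 |].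
  apply: (ideal_mul_ind (C := fun t => OK K (d * e * t))).
  + by rewrite mulr0; apply: OK0.
  + by move=> u v; rewrite mulrDr; apply: OKD.
  + by move=> u v /Ad OKu /Be OKv; rewrite mulrACA; apply: OKM.
Qed.

Lemma nonzero_ideal_mul (A B : set algC) :
  nonzero_ideal K A -> nonzero_ideal K B -> nonzero_ideal K (ideal_mul A B).
Proof.
move=> [fA AO] [fB BO]; split; first exact: fractional_ideal_mul.
by apply: ideal_mul_ind => [|u v|u v /AO Ou /BO Ov];
  [exact: OK0 | exact: OKD | exact: OKM].
Qed.

Lemma fractional_ideal_principal (nu : algC) : K nu -> nu != 0 ->
  (exists d, [/\ OK K d, d != 0 & OK K (d * nu)]) ->
  fractional_ideal K (principal K nu).
Proof.
move=> Knu nu0 [d [OKd d0 OKdnu]]; split; first split.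
- by move=> _ [x [Kx _] <-]; apply: subfield_setM.
- by exists 0; [exact: OK0 | rewrite mulr0].
- by move=> _ _ [x OKx <-] [y OKy <-]; exists (x + y);
  [exact: OKD | rewrite mulrDr].
- by move=> r _ OKr [x OKx <-]; exists (r * x); [exact: OKM | rewrite mulrCA].
- by exists nu => //; exists 1; [exact: OK1 | rewrite mulr1].
- by exists d; split=> // _ [x OKx <-]; rewrite mulrA; apply: OKM.
Qed.

Lemma nonzero_ideal_principal (nu : algC) : OK K nu -> nu != 0 ->
  nonzero_ideal K (principal K nu).
Proof.
move=> OKnu nu0; split; last by move=> _ [x OKx <-]; apply: OKM.
apply: fractional_ideal_principal => //; first by case: OKnu.
by exists 1; rewrite mul1r oner_eq0; split=> //; apply: OK1.
Qed.

Lemma ideal_mul_principal (A : set algC) (nu : algC) : OK_submodule K A ->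
  ideal_mul A (principal K nu) = [set nu * x | x in A].
Proof.
move=> [_ A0 AD AM]; rewrite eqEsubset; split.
  apply: ideal_mul_ind => [|_ _ [x Ax <-] [y Ay <-]|x _ Ax [r OKr <-]].
  - by exists 0; rewrite ?mulr0.
  - by exists (x + y); [exact: AD | rewrite mulrDr].
  - by exists (r * x); [exact: AM | ring].
move=> _ [x Ax <-]; rewrite mulrC; apply: ideal_mul_mem => //.
by exists 1; [exact: OK1 | rewrite mulr1].
Qed.

Lemma OK_submodule_principal (nu : algC) : K nu -> OK_submodule K (principal K
  nu).
Proof.
move=> Knu; split.
- by move=> _ [x [Kx _] <-]; apply: subfield_setM.
- by exists 0; [exact: OK0 | rewrite mulr0].
- by move=> _ _ [x OKx <-] [y OKy <-]; exists (x + y);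
  [exact: OKD | rewrite mulrDr].
- by move=> r _ OKr [x OKx <-]; exists (r * x); [exact: OKM | rewrite mulrCA].
Qed.

Lemma principal_mul (mu nu : algC) : K mu ->
  ideal_mul (principal K mu) (principal K nu) = principal K (mu * nu).
Proof.
move=> Kmu; rewrite ideal_mul_principal; last exact: OK_submodule_principal.
rewrite eqEsubset; split=> [_ [_ [x OKx <-] <-] | _ [x OKx <-]].
  by exists x => //; rewrite mulrA [mu * _]mulrC.
by exists (mu * x); [exists x | rewrite mulrA [nu * _]mulrC].
Qed.

Lemma principal1 : principal K 1 = OK K.
Proof.
rewrite eqEsubset; split=> [_ [x OKx <-] | x OKx]; first by rewrite mul1r.
by exists x; rewrite ?mul1r.
Qed.

Variable n : set algC.
Hypothesis hn : nonzero_ideal K n.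

Lemma nonzero_idealM r x : OK K r -> n x -> n (r * x).
Proof. by case: hn => [[[_ _ _ +] _ _] _]; apply. Qed.

Lemma nonzero_idealD x y : n x -> n y -> n (x + y).
Proof. by case: hn => [[[_ _ + _] _ _] _]; apply. Qed.

Lemma nonzero_idealN x : n x -> n (- x).
Proof. by rewrite -mulN1r; apply: nonzero_idealM; rewrite -sub0r;
  apply: OKB OK0 OK1. Qed.

Lemma nonzero_ideal0 : n 0.
Proof. by case: hn => [[[]]]. Qed.

Lemma comaximal_mul (A B : set algC) : A `<=` OK K -> B `<=` OK K ->
  comaximal A n -> comaximal B n -> comaximal (ideal_mul A B) n.
Proof.
move=> AO BO [x [y [Ax ny e1]]] [x' [y' [Bx' ny' e2]]].
exists (x * x'), (x * y' + y * 1); split; first exact: ideal_mul_mem.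
  apply: nonzero_idealD; first by apply: nonzero_idealM => //; apply: AO.
  by rewrite mulrC; apply: nonzero_idealM => //; apply: OK1.
by rewrite addrA -mulrDr e2 -mulrDl e1 mulr1.
Qed.

Lemma mcong1_1 : mcong1 K n 1.
Proof.
exists 1, 1; split; first by split; rewrite ?oner_eq0 //; apply: OK1.
rewrite principal1 subrr divr1; split=> //; last exact: nonzero_ideal0.
by exists 1, 0; split; [exact: OK1 | exact: nonzero_ideal0 | rewrite addr0].
Qed.

(** If beta x + y = 1, replacing beta by alpha changes the left side by an element of n, which y
    absorbs. This lets numerator and denominator be exchanged when nu =* 1 is inverted. *)
Lemma comaximal_cong (alpha beta : algC) : n (alpha - beta) ->
  comaximal (principal K beta) n -> comaximal (principal K alpha) n.
Proof.
move=> nab [_ [y [[x OKx <-] ny e1]]].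
exists (alpha * x), (y - x * (alpha - beta)); split; first by exists x.
  by apply: nonzero_idealD => //; apply: nonzero_idealN; apply: nonzero_idealM.
by rewrite -e1; ring.
Qed.

Lemma mcong1_mul (mu nu : algC) :
  mcong1 K n mu -> mcong1 K n nu -> mcong1 K n (mu * nu).
Proof.
move=> [al [be [[OKal OKbe be0] [cbe nab ->]]]].
move=> [al' [be' [[OKal' OKbe' be'0] [cbe' nab' ->]]]].
exists (al * al'), (be * be'); split.
  by split; [exact: OKM | exact: OKM | exact: mulf_neq0].
split; last by rewrite mulf_div.
  rewrite -principal_mul; last by case: OKbe.
  by apply: comaximal_mul => // _ [x OKx <-]; apply: OKM.
rewrite (_ : _ - _ = al' * (al - be) + be * (al' - be')); last by ring.
by apply: nonzero_idealD; apply: nonzero_idealM.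
Qed.

Lemma mcong1_inv (nu : algC) : nu != 0 -> mcong1 K n nu -> mcong1 K n nu^-1.
Proof.
move=> + [al [be [[OKal OKbe be0] [cbe nab Dnu]]]]; rewrite {}Dnu => nu0.
have al0 : al != 0 by apply: contraNneq nu0 => ->; rewrite mul0r.
exists be, al; split=> //; rewrite invf_div; split=> //.
  exact: comaximal_cong cbe.
by rewrite -opprB; apply: nonzero_idealN.
Qed.

Lemma P_K1_1 : P_K1 K n (OK K).
Proof.
exists 1; last exact: principal1.
by case: subK => K1 _ _ _; split; rewrite ?oner_eq0 //; apply: mcong1_1.
Qed.

Lemma P_K1_mul (P P' : set algC) :
  P_K1 K n P -> P_K1 K n P' -> P_K1 K n (ideal_mul P P').
Proof.
move=> [mu [Kmu mu0 cmu] <-] [nu [Knu nu0 cnu] <-]; rewrite principal_mul //.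
by exists (mu * nu) => //; split; [exact: subfield_setM | exact: mulf_neq0 |
  exact: mcong1_mul].
Qed.

Lemma P_K1_inv (P : set algC) : P_K1 K n P ->
  exists2 P', P_K1 K n P' & ideal_mul P P' = OK K.
Proof.
move=> [nu [Knu nu0 cnu] <-]; exists (principal K nu^-1).
  by exists nu^-1 => //; split; [exact: subfield_setV | rewrite invr_eq0 |
    exact: mcong1_inv].
by rewrite principal_mul // divff // principal1.
Qed.

Lemma ideal_mul1 (A : set algC) : OK_submodule K A -> ideal_mul A (OK K) = A.
Proof.
move=> subA; rewrite -principal1 ideal_mul_principal // eqEsubset.
split=> [_ [x Ax <-] | x Ax]; first by rewrite mul1r.
by exists x; rewrite ?mul1r.
Qed.

Lemma I_K_mul (A B : set algC) : I_K K n A -> I_K K n B -> I_K K n (ideal_mul A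
  B).
Proof.
move=> [fA [A1 [A2 [nA1 nA2 cA1 cA2 eA]]]] [fB [B1 [B2 [nB1 nB2 cB1 cB2 eB]]]].
split; first exact: fractional_ideal_mul.
exists (ideal_mul A1 B1), (ideal_mul A2 B2); split.
- exact: nonzero_ideal_mul.
- exact: nonzero_ideal_mul.
- by apply: comaximal_mul => //; [case: nA1 | case: nB1].
- by apply: comaximal_mul => //; [case: nA2 | case: nB2].
- by rewrite ideal_mulACA eA eB.
Qed.

Lemma P_K1_I_K (P : set algC) : P_K1 K n P -> I_K K n P.
Proof.
move=> [nu [Knu nu0 [al [be [[OKal OKbe be0] [cbe nab Dnu]]]]] <-].
have al0 : al != 0 by apply: contraNneq nu0 => al0; rewrite Dnu al0 mul0r.
have Dal : nu * be = al by rewrite Dnu divfK.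
split.
  by apply: fractional_ideal_principal => //; exists be; rewrite mulrC Dal.
exists (principal K al), (principal K be); split.
- exact: nonzero_ideal_principal.
- exact: nonzero_ideal_principal.
- exact: comaximal_cong cbe.
- by [].
- by rewrite principal_mul // Dal.
Qed.

Lemma ray_mul_class (A B : set algC) : I_K K n A -> I_K K n B ->
  ray_mul (ray_class K n A) (ray_class K n B) = ray_class K n (ideal_mul A B).
Proof.
move=> iA iB; rewrite eqEsubset; split=> [_ [C [iC [P PP DC]] [D [iD [P' PP'
  DD]] <-]] | C [_ [P PP ->]]].
  rewrite {}DC in iC *; rewrite {}DD in iD *; split; first exact: I_K_mul.
  by exists (ideal_mul P P'); [exact: P_K1_mul | rewrite ideal_mulACA].
have sA : OK_submodule K A by case: iA => [[]].
exists A; first by split=> //; exists (OK K); [exact: P_K1_1 | rewrite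
  ideal_mul1].
exists (ideal_mul B P); last by rewrite ideal_mulA.
by split; [apply: I_K_mul => //; apply: P_K1_I_K | exists P].
Qed.

Lemma ray_class_mulP (A P : set algC) : OK_submodule K A -> P_K1 K n P ->
  ray_class K n (ideal_mul A P) = ray_class K n A.
Proof.
move=> sA PP; rewrite eqEsubset; split=> C [iC [P' PP' DC]]; split=> //;
  rewrite {}DC {C iC}.
  by exists (ideal_mul P P'); [exact: P_K1_mul | rewrite ideal_mulA].
have [P'' PP'' PP''1] := P_K1_inv PP.
exists (ideal_mul P'' P'); first exact: P_K1_mul.
by rewrite -ideal_mulA [ideal_mul P _]ideal_mulA PP''1 ideal_mulA ideal_mul1.
Qed.

End RayClasses.

(** * Lattices and the ring of integers *)

Lemma lattice_mem (al be : algC) (m k : int) : lattice al be (m%:~R * al +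
  k%:~R * be).
Proof. by exists m, k. Qed.

Lemma lattice0 (al be : algC) : lattice al be 0.
Proof. by exists 0, 0; rewrite !mul0r addr0. Qed.

Lemma latticeD (al be x y : algC) :
  lattice al be x -> lattice al be y -> lattice al be (x + y).
Proof.
move=> [m [k ->]] [m' [k' ->]]; exists (m + m'), (k + k').
by rewrite !rmorphD /=; ring.
Qed.

Lemma latticeZ (al be x : algC) (m : int) :
  lattice al be x -> lattice al be (m%:~R * x).
Proof.
move=> [p [k ->]]; exists (m * p), (m * k).
by rewrite !rmorphM /=; ring.
Qed.

Lemma lattice_sub (al be : algC) (L : set algC) :
  (forall x y, L x -> L y -> L (x + y)) -> (forall (m : int) x, L x -> L (m%:~R
    * x)) ->
  L al -> L be -> lattice al be `<=` L.
Proof. by move=> LD LZ La Lb _ [m [k ->]]; apply: LD; apply: LZ. Qed.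

Lemma lattice_sub_lattice (al be al' be' : algC) :
  lattice al' be' al -> lattice al' be' be -> lattice al be `<=` lattice al'
    be'.
Proof. by apply: lattice_sub => *; [apply: latticeD | apply: latticeZ]. Qed.

Lemma lattice_eq (al be al' be' : algC) :
  lattice al' be' al -> lattice al' be' be ->
  lattice al be al' -> lattice al be be' -> lattice al be = lattice al' be'.
Proof. by move=> *; rewrite eqEsubset; split; apply: lattice_sub_lattice. Qed.

Lemma lattice_scale (nu al be : algC) :
  lattice (nu * al) (nu * be) = [set nu * x | x in lattice al be].
Proof.
rewrite eqEsubset; split=> [_ [m [k ->]] | _ [_ [m [k ->]] <-]].
  by exists (m%:~R * al + k%:~R * be); [exists m, k | ring].
by exists m, k; ring.
Qed.

Lemma sqrtd_sqr (d : int) : sqrtd d ^+ 2 = d%:~R.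
Proof. exact: sqrtCK. Qed.

Lemma sqrtd_indep (d x y : int) : d < 0 ->
  x%:~R * sqrtd d + y%:~R = 0 -> x = 0 /\ y = 0.
Proof.
move=> d0 e.
have e2 : x ^+ 2 * d = y ^+ 2.
  apply: (intr_inj (R := algC)); rewrite rmorphM !rmorphXn /= -(sqrtd_sqr d).
  by rewrite -exprMn (_ : _ * _ = - y%:~R) ?sqrrN //; apply/eqP;
    rewrite -addr_eq0 e.
have y0 : y = 0.
  apply/eqP; rewrite -sqrf_eq0 eq_le sqr_ge0 -e2 andbT.
  by rewrite nmulr_lle0 // sqr_ge0.
split=> //; move/eqP: e2; rewrite y0 expr0n mulf_eq0 (lt_eqF d0) orbF sqrf_eq0.
by move/eqP.
Qed.

(* Since 1 extends to a basis (w, 1) of OK, w is a root of a monic quadratic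
   polynomial over Z, whose discriminant is d. *)
Lemma OK_lattice (K : set algC) (d b k : int) : subfield_set K ->
  field_disc K d -> d < 0 -> b ^+ 2 = d + 4 * k ->
  OK K = lattice ((- b%:~R + sqrtd d) / 2) 1.
Proof.
move=> subK [w1 [w2 [OKE indep dE]]] d0 bE.
have [m [l e1]] : lattice w1 w2 1 by rewrite -OKE; apply: OK1.
have [u [v Dg]] := Bezoutz m l.
(* If g divides both coordinates of 1, then 1/g lies in OK; a rational algebraic integer is an
   integer, so g divides 1. *)
have g1 : gcdz m l = 1.
  have /dvdzP[m' Dm] := dvdz_gcdl m l; have /dvdzP[l' Dl] := dvdz_gcdr m l.
  move: Dg Dm Dl; move: (gcdz m l) (isT : 0 <= gcdz m l) => g g0 Dg Dm Dl.
  pose t := m'%:~R * w1 + l'%:~R * w2.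
  have gt1 : g%:~R * t = 1.
    by rewrite [RHS]e1 Dm Dl /t !rmorphM /=; ring.
  have gn0 : g%:~R != 0 :> algC.
    by apply: contra_eq_neq gt1 => ->; rewrite mul0r eq_sym oner_eq0.
  have [_ At] : OK K t by rewrite OKE; apply: lattice_mem.
  have tE : t = g%:~R^-1 by apply: (mulfI gn0); rewrite gt1 mulfV.
  have /intrP[s Ds] : t \is a Num.int.
    by apply: Cint_rat_Aint At; rewrite tE rpredV rpred_int.
  have : (g %| 1)%Z.
    apply/dvdzP; exists s; apply: (intr_inj (R := algC)).
    by rewrite rmorphM /= -Ds mulrC gt1.
  by rewrite dvdz1 => /eqP; lia.
rewrite g1 in Dg.
(* The Bezout coefficients complete 1 to a basis: the change of basis to (w, 1) has determinant -(u
   m + v l) = -1, so the discriminant is unchanged. *)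
pose w := - v%:~R * w1 + u%:~R * w2.
have Dg' : u%:~R * m%:~R + v%:~R * l%:~R = 1 :> algC.
  by rewrite -!rmorphM -rmorphD /= Dg.
have Dw1 : w1 = u%:~R - l%:~R * w.
  have -> : u%:~R = u%:~R * (m%:~R * w1 + l%:~R * w2) by rewrite -e1 mulr1.
  by rewrite /w [RHS](_ : _ = (u%:~R * m%:~R + v%:~R * l%:~R) * w1);
    [rewrite Dg' mul1r | ring].
have Dw2 : w2 = v%:~R + m%:~R * w.
  have -> : v%:~R = v%:~R * (m%:~R * w1 + l%:~R * w2) by rewrite -e1 mulr1.
  by rewrite /w [RHS](_ : _ = (u%:~R * m%:~R + v%:~R * l%:~R) * w2);
    [rewrite Dg' mul1r | ring].
have OKw : OK K = lattice w 1.
  rewrite OKE; apply: lattice_eq.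
  - by exists (- l), u; rewrite Dw1 rmorphN /=; ring.
  - by exists m, v; rewrite Dw2; ring.
  - by exists (- v), u; rewrite rmorphN.
  - by exists m, l.
clearbody w.
have dE' : d%:~R = (w - w^*) ^+ 2.
  rewrite dE Dw1 Dw2 !rmorphB !rmorphD !rmorphM /= !rmorph_int.
  have -> : (w - w^*) ^+ 2 = (u%:~R * m%:~R + v%:~R * l%:~R) ^+ 2 * (w - w^*)
    ^+ 2.
    by rewrite Dg' expr1n mul1r.
  by ring.
have [p [q ew]] : lattice w 1 (w * w).
  by rewrite -OKw; apply: OKM => //; rewrite OKw; exists 1, 0;
    rewrite mul1r mul0r addr0.
have wn : w - w^* != 0.
  by apply: contraTneq d0 => w0; rewrite -(ltrz0 algC) dE' w0 expr0n ltxx.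
(* Subtract from w^2 = p w + q its conjugate and divide by w - w^*, which is nonzero because d
   is. *)
have trw : w + w^* = p%:~R.
  apply: (mulfI wn).
  have ew' : w^* * w^* = p%:~R * w^* + q%:~R.
    by rewrite -rmorphM ew rmorphD !rmorphM /= !rmorph_int rmorph1 mulr1.
  rewrite (_ : _ * _ = w * w - w^* * w^*); last by ring.
  by rewrite ew ew'; ring.
have dE2 : d = p ^+ 2 + 4 * q.
  apply: (intr_inj (R := algC)).
  rewrite dE' (_ : w^* = p%:~R - w); last by rewrite -trw addrC addKr.
  rewrite rmorphD rmorphM rmorphXn /= (_ : (w - _) ^+ 2 = 4 * (w * w) - 4 * w *
    p%:~R + p%:~R ^+ 2); last by ring.
  by rewrite ew; ring.
(* p^2 and b^2 are both congruent to d modulo 4, so p and b have the same parity. *)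
have [h Dh] : exists h, p = b + 2 * h.
  have : (2 %| (p - b) ^+ 2)%Z.
    apply/dvdzP; exists (d - 2 * q + 2 * k - p * b); lia.
  by rewrite dvdzE abszX Euclid_dvdX // andbT => /(@dvdzP 2 (p - b)) [h Dh];
    exists h; lia.
have two0 : 2 != 0 :> algC by rewrite pnatr_eq0.
have: (2 * w - p%:~R) ^+ 2 = sqrtd d ^+ 2.
  rewrite sqrtd_sqr dE2 rmorphD rmorphM rmorphXn /=.
  rewrite (_ : (_ - _) ^+ 2 = 4 * (w * w) - 4 * w * p%:~R + p%:~R ^+ 2);
    last by ring.
  by rewrite ew; ring.
have Dh' : p%:~R = b%:~R + 2 * h%:~R :> algC by rewrite Dh rmorphD rmorphM.
(* The given basis does not tell which square root of d is 2 w - p; either sign gives the same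
   lattice, since w and h - w span the same lattice together with 1. *)
move/eqP; rewrite eqf_sqr OKw => /orP[] /eqP e.
  have Ds : sqrtd d = 2 * w - p%:~R by rewrite e.
  rewrite Ds (_ : _ / 2 = w - b%:~R - h%:~R); last by rewrite Dh'; field.
  apply: lattice_eq.
  - by exists 1, (b + h); rewrite rmorphD /=; ring.
  - by exists 0, 1; ring.
  - by exists 1, (- b - h); rewrite rmorphB rmorphN /=; ring.
  - by exists 0, 1; ring.
have Ds : sqrtd d = p%:~R - 2 * w by rewrite -[RHS]opprB e opprK.
rewrite Ds (_ : _ / 2 = h%:~R - w); last by rewrite Dh'; field.
apply: lattice_eq.
- by exists (-1), h; rewrite rmorphN1; ring.
- by exists 0, 1; ring.
- by exists (-1), h; rewrite rmorphN1; ring.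
- by exists 0, 1; ring.
Qed.

(** * Lattices of forms *)

Section FormLattices.

Variable d : int.

Lemma omega_mul2a (Q : bqf) : Qforms d Q ->
  2 * (qa Q)%:~R * omega d Q = - (qb Q)%:~R + sqrtd d.
Proof.
move=> [_ /qa_gt0 a0 _]; rewrite mulrC divfK // mulf_neq0 ?pnatr_eq0 //.
by rewrite intr_eq0 gt_eqF.
Qed.

Lemma qa_neq0 (Q : bqf) : Qforms d Q -> (qa Q)%:~R != 0 :> algC.
Proof. by move=> [_ /qa_gt0 a0 _]; rewrite intr_eq0 gt_eqF. Qed.

Lemma disc_intr (Q : bqf) : Qforms d Q ->
  d%:~R = (qb Q)%:~R ^+ 2 - 4 * (qa Q)%:~R * (qc Q)%:~R :> algC.
Proof. by move=> [_ _ <-]; rewrite /bqf_disc rmorphB rmorphXn !rmorphM. Qed.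

Lemma omega_root (Q : bqf) : Qforms d Q ->
  (qa Q)%:~R * omega d Q ^+ 2 = - (qb Q)%:~R * omega d Q - (qc Q)%:~R.
Proof.
move=> hQ; have a0 := qa_neq0 hQ; have w2 := omega_mul2a hQ.
apply: (@mulfI _ (4 * (qa Q)%:~R)); first by rewrite mulf_neq0 ?pnatr_eq0.
rewrite [LHS](_ : _ = (2 * (qa Q)%:~R * omega d Q) ^+ 2); last by ring.
rewrite [RHS](_ : _ = - 2 * (qb Q)%:~R * (2 * (qa Q)%:~R * omega d Q)
  - 4 * (qa Q)%:~R * (qc Q)%:~R); last by ring.
rewrite w2 [LHS](_ : _ = (qb Q)%:~R ^+ 2 - 2 * (qb Q)%:~R * sqrtd d + sqrtd d
  ^+ 2); last by ring.
by rewrite sqrtd_sqr (disc_intr hQ); ring.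
Qed.

Lemma omega_indep (Q : bqf) (x y : int) : Qforms d Q ->
  x%:~R * omega d Q + y%:~R = 0 -> x = 0 /\ y = 0.
Proof.
move=> hQ e; have w2 := omega_mul2a hQ.
have d0 : d < 0 by case: hQ => _ /posdef_disc_lt0 + <-.
have a0 : qa Q != 0 by case: hQ => _ /qa_gt0 a0 _; rewrite gt_eqF.
have [] : x = 0 /\ 2 * qa Q * y - x * qb Q = 0.
  apply: (sqrtd_indep d0); rewrite rmorphB !rmorphM /=.
  rewrite [LHS](_ : _ = x%:~R * (- (qb Q)%:~R + sqrtd d) + 2 * (qa Q)%:~R *
    y%:~R); last by ring.
  rewrite -w2 [LHS](_ : _ = 2 * (qa Q)%:~R * (x%:~R * omega d Q + y%:~R));
    last by ring.
  by rewrite e mulr0.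
move=> ->; rewrite mul0r subr0 => /eqP; rewrite !mulf_eq0 (negPf a0) /=.
by move/eqP.
Qed.

Lemma det_intr (g : 'M[int]_2) : \det g = 1 ->
  (g 0 0)%:~R * (g 1 1)%:~R - (g 0 1)%:~R * (g 1 0)%:~R = 1 :> algC.
Proof. by rewrite det_mx2 -!rmorphM -rmorphB /= => ->. Qed.

Lemma jfac_neq0 (Q : bqf) (g : 'M[int]_2) : Qforms d Q -> \det g = 1 ->
  jfac g (omega d Q) != 0.
Proof.
move=> hQ g1; apply/eqP => /(omega_indep hQ)[r0 s0].
by move: g1; rewrite det_mx2 r0 s0 !mulr0 subr0.
Qed.

(** The Moebius relation omega_Q = g(omega_{Q^g}), cleared of its denominator. As [omega] is a
    formula in one fixed square root of d, the right root comes out of the computation. *)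
Lemma omega_act (Q : bqf) (g : 'M[int]_2) : Qforms d Q -> \det g = 1 ->
  omega d Q * jfac g (omega d (bqf_act Q g)) =
  (g 0 0)%:~R * omega d (bqf_act Q g) + (g 0 1)%:~R.
Proof.
move=> hQ g1; have hQ' := Qforms_act g1 hQ.
have a0 := qa_neq0 hQ; have a'0 := qa_neq0 hQ'.
have w2 := omega_mul2a hQ; have w2' := omega_mul2a hQ'.
have sd := sqrtd_sqr d; rewrite (disc_intr hQ) in sd; have D1 := det_intr g1.
apply: (@mulfI _ (4 * (qa Q)%:~R * (qa (bqf_act Q g))%:~R)).
  by rewrite !mulf_neq0 ?pnatr_eq0.
rewrite /jfac [LHS](_ : _ = (2 * (qa Q)%:~R * omega d Q)
  * ((g 1 0)%:~R * (2 * (qa (bqf_act Q g))%:~R * omega d (bqf_act Q g))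
     + 2 * (qa (bqf_act Q g))%:~R * (g 1 1)%:~R)); last by ring.
rewrite [RHS](_ : _ = 2 * (qa Q)%:~R * ((g 0 0)%:~R * (2 * (qa (bqf_act Q
  g))%:~R * omega d (bqf_act Q g))
     + 2 * (qa (bqf_act Q g))%:~R * (g 0 1)%:~R)); last by ring.
rewrite w2 w2' /= !(rmorphD, rmorphM, rmorphXn) /=.
move: sd D1; move: (sqrtd d) (qa Q)%:~R (qb Q)%:~R (qc Q)%:~R.
move: (g 0 0)%:~R (g 0 1)%:~R (g 1 0)%:~R (g 1 1)%:~R.
move=> p q r t s a b c sd D1; apply/eqP; rewrite -subr_eq0; apply/eqP.
(* The difference of the two sides, as a combination of the relations s^2 = b^2 - 4 a c and det g =
   1. *)
transitivity (r * (s ^+ 2 - (b ^+ 2 - 4 * a * c))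
  + (s * (2 * a * p + b * r) - r * (b ^+ 2 - 4 * a * c)) * (p * t - q * r - 1)).
  by ring.
by rewrite sd D1 !subrr !mulr0 addr0.
Qed.

(** j omega_Q and j are the images of the basis (w, 1) under the unimodular g, hence again a basis
    of [w, 1]. *)
Lemma lattice_act (Q : bqf) (g : 'M[int]_2) : Qforms d Q -> \det g = 1 ->
  let w := omega d (bqf_act Q g) in let j := jfac g w in
  lattice (omega d Q) 1 = lattice (w / j) (1 / j).
Proof.
move=> hQ g1 w j; have j0 : j != 0 by apply: jfac_neq0 => //; apply: Qforms_act.
have wE : omega d Q = ((g 0 0)%:~R * w + (g 0 1)%:~R) / j.
  by rewrite -omega_act // mulfK.
have D1 := det_intr g1.
rewrite wE; apply: lattice_eq.
- by exists (g 0 0), (g 0 1); field.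
- by exists (g 1 0), (g 1 1); rewrite -(divff j0) /j /jfac; field.
- exists (g 1 1), (- g 0 1); rewrite rmorphN /=.
  rewrite [RHS](_ : _ = ((g 1 1)%:~R * ((g 0 0)%:~R * w + (g 0 1)%:~R) - (g 0
    1)%:~R * j) / j).
    rewrite [X in _ = X / j](_ : _ = ((g 0 0)%:~R * (g 1 1)%:~R - (g 0 1)%:~R *
      (g 1 0)%:~R) * w).
      by rewrite D1 mul1r.
    by rewrite /j /jfac; ring.
  by field.
- exists (- g 1 0), (g 0 0); rewrite rmorphN /=.
  rewrite [RHS](_ : _ = (- (g 1 0)%:~R * ((g 0 0)%:~R * w + (g 0 1)%:~R) + (g 0
    0)%:~R * j) / j).
    rewrite [X in _ = X / j](_ : _ = (g 0 0)%:~R * (g 1 1)%:~R - (g 0 1)%:~R *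
      (g 1 0)%:~R).
      by rewrite D1.
    by rewrite /j /jfac; ring.
  by field.
Qed.

Variable K : set algC.
Hypotheses (subK : subfield_set K) (hd : field_disc K d).

Lemma OK_form (Q : bqf) : Qforms d Q -> OK K = lattice ((qa Q)%:~R * omega d Q)
  1.
Proof.
move=> hQ; have d0 : d < 0 by case: hQ => _ /posdef_disc_lt0 + <-.
rewrite (_ : _ * _ = (- (qb Q)%:~R + sqrtd d) / 2); last first.
  by rewrite -omega_mul2a //; field.
apply: (OK_lattice (k := qa Q * qc Q)) => //.
by case: hQ => _ _ <-; rewrite /bqf_disc; ring.
Qed.

Lemma jfac_in_K (g : 'M[int]_2) (x : algC) : K x -> K (jfac g x).
Proof.
by move=> Kx; apply: (subfield_setD subK); [apply: (subfield_setM subK) =>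
  //|]; apply: subfield_set_int.
Qed.

Lemma omega_in_K (Q : bqf) : Qforms d Q -> K (omega d Q).
Proof.
move=> hQ; have a0 := qa_neq0 hQ.
rewrite -[omega d Q](mulKf a0); apply: subfield_setM => //;
  first by apply: subfield_setV => //; apply: subfield_set_int.
have [] // : OK K ((qa Q)%:~R * omega d Q).
by rewrite (OK_form hQ); exists 1, 0; ring.
Qed.

Lemma lattice_in_K (Q : bqf) : Qforms d Q -> lattice (omega d Q) 1 `<=` K.
Proof.
move=> hQ _ [m [k ->]]; apply: subfield_setD => //; apply: subfield_setM => //;
  try exact: subfield_set_int.
  exact: omega_in_K.
by case: subK.
Qed.

Lemma form_lattice_OK (Q : bqf) (x : algC) : Qforms d Q ->
  lattice (omega d Q) 1 x -> OK K ((qa Q)%:~R * x).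
Proof.
move=> hQ [m [k ->]]; rewrite (OK_form hQ); exists m, (k * qa Q).
by rewrite rmorphM /=; ring.
Qed.

Lemma form_lattice_fractional (Q : bqf) : Qforms d Q ->
  fractional_ideal K (lattice (omega d Q) 1).
Proof.
move=> hQ; split; first split.
- exact: lattice_in_K.
- exact: lattice0.
- exact: latticeD.
- move=> r x; rewrite (OK_form hQ) => -[m [k ->]] [m' [k' ->]].
  exists (- (m * m' * qb Q) + m * k' * qa Q + k * m'), (k * k' - m * m' * qc Q).
  rewrite !(rmorphD, rmorphN, rmorphB, rmorphM) /=.
  rewrite [LHS](_ : _ = m%:~R * m'%:~R * ((qa Q)%:~R * omega d Q ^+ 2)
    + m%:~R * k'%:~R * ((qa Q)%:~R * omega d Q)
    + k%:~R * m'%:~R * omega d Q + k%:~R * k'%:~R); last by ring.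
  by rewrite omega_root //; ring.
- by exists 1; [exists 0, 1; ring | rewrite oner_eq0].
- exists (qa Q)%:~R; split; [exact: OK_int | exact: qa_neq0 |].
  by move=> x; apply: form_lattice_OK.
Qed.

Variables (n : set algC) (N : nat).
Hypotheses (hn : nonzero_ideal K n) (nN : n N%:R).

Lemma comaximal_int (a : int) : coprimez N a -> comaximal (principal K a%:~R) n.
Proof.
move=> /coprimezP[[u v] /= e]; exists (a%:~R * v%:~R), (u%:~R * N%:R); split.
- by exists v%:~R => //; apply: OK_int.
- by apply: (nonzero_idealM hn) => //; apply: OK_int.
- by rewrite -[N%:R]/(N%:Z%:~R) -!rmorphM -rmorphD /= [a * v]mulrC addrC e.
Qed.

Lemma form_lattice_I_K (Q : bqf) : QNforms N d Q -> I_K K n (lattice (omega d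
  Q) 1).
Proof.
move=> [hQ cN]; have fA := form_lattice_fractional hQ; split=> //.
have sA : OK_submodule K (lattice (omega d Q) 1) by case: fA.
have npa : nonzero_ideal K (principal K (qa Q)%:~R).
  by apply: nonzero_ideal_principal; [|exact: OK_int | exact: qa_neq0].
(* For A = [omega_Q, 1], the ideal a A is integral and contains a because 1 lies in A; so a A and
   (a) are both prime to n. *)
exists (ideal_mul (lattice (omega d Q) 1) (principal K (qa Q)%:~R)), (principal
  K (qa Q)%:~R).
split=> //; last exact: comaximal_int.
- split; first by apply: fractional_ideal_mul => //; case: npa.
  by rewrite ideal_mul_principal // => _ [x Lx <-]; apply: form_lattice_OK.
- have [_ [y [[x OKx <-] ny e]]] := comaximal_int cN.
  exists ((qa Q)%:~R * x), y; split=> //; rewrite ideal_mul_principal //.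
  exists x => //; rewrite -[x]mulr1; case: sA => _ _ _; apply => //.
  by exists 0, 1; ring.
Qed.

End FormLattices.

(** * Products of lattices of concordant forms *)

Lemma ideal_mul_latticeZ (al be : algC) (A : set algC) (m : int) (x : algC) :
  ideal_mul (lattice al be) A x -> ideal_mul (lattice al be) A (m%:~R * x).
Proof.
move: x; apply: ideal_mul_ind => [|x y|x y Lx Ay].
- by rewrite mulr0; apply: ideal_mul0.
- by rewrite mulrDr; apply: ideal_mulD.
- by rewrite mulrA; apply: ideal_mul_mem => //; apply: latticeZ.
Qed.

Lemma lattice_mul_concordant (w nu : algC) (a e B C x y z : int) :
  (a * e)%:~R * w ^+ 2 = - B%:~R * w - C%:~R -> x * a + y * e + z * B = 1 ->
  ideal_mul (lattice (e%:~R * w) 1) (lattice (a%:~R * w * nu) nu) =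
  lattice (w * nu) nu.
Proof.
move=> w2 e1; rewrite rmorphM /= in w2.
rewrite eqEsubset; split.
  apply: ideal_mul_ind => [||_ _ [m [k ->]] [m' [k' ->]]].
  - exact: lattice0.
  - exact: latticeD.
  exists (- m * m' * B + m * e * k' + k * m' * a), (k * k' - m * m' * C).
  rewrite !(rmorphD, rmorphB, rmorphM, rmorphN) /=.
  rewrite [LHS](_ : _ = (m%:~R * m'%:~R * (a%:~R * e%:~R * w ^+ 2)
    + (m%:~R * e%:~R * k'%:~R + k%:~R * m'%:~R * a%:~R) * w + k%:~R * k'%:~R) *
      nu); last by ring.
  by rewrite w2; ring.
have L1 : lattice (e%:~R * w) 1 1 by exists 0, 1; ring.
have Le : lattice (e%:~R * w) 1 (e%:~R * w) by exists 1, 0; ring.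
have L1' : lattice (a%:~R * w * nu) nu nu by exists 0, 1; ring.
have La : lattice (a%:~R * w * nu) nu (a%:~R * w * nu) by exists 1, 0; ring.
have Inu := ideal_mul_mem L1 L1'.
apply: lattice_sub; last by rewrite -[X in ideal_mul _ _ X]mul1r.
- exact: ideal_mulD.
- by move=> m u; apply: ideal_mul_latticeZ.
(* Up to nu, the product contains a w, e w and C + a e w^2 = - B w; the relation x a + y e + z B = 1
   extracts w. *)
have -> : w * nu = x%:~R * (1 * (a%:~R * w * nu)) + y%:~R * (e%:~R * w * nu)
    + (- z)%:~R * (C%:~R * (1 * nu) + e%:~R * w * (a%:~R * w * nu)).
  have e1' : x%:~R * a%:~R + y%:~R * e%:~R + z%:~R * B%:~R = 1 :> algC.
    by rewrite -!rmorphM -!rmorphD /= e1.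
  rewrite rmorphN /= [RHS](_ : _ = ((x%:~R * a%:~R + y%:~R * e%:~R) * w
    - z%:~R * C%:~R - z%:~R * (a%:~R * e%:~R * w ^+ 2)) * nu); last by ring.
  rewrite w2 [RHS](_ : _ = (x%:~R * a%:~R + y%:~R * e%:~R + z%:~R * B%:~R) * w
    * nu); last by ring.
  by rewrite e1' mul1r.
by repeat first [apply: ideal_mulD | apply: ideal_mul_latticeZ | apply:
  ideal_mul_mem].
Qed.

Lemma omega_mul_qa (d a e b c c' k : int) : a != 0 -> e != 0 ->
  omega d (BQF a b c) = e%:~R * omega d (BQF (a * e) (b + k * (2 * a)) c') +
    k%:~R.
Proof.
rewrite -!(intr_eq0 algC) => a0 e0; rewrite /omega /= !(rmorphD, rmorphM) /=.
by field; rewrite e0 a0.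
Qed.

Section Product.

Variables (d : int) (Q Q' : bqf) (gamma : 'M[int]_2) (B k l : int).
Let Q'' := bqf_act Q' gamma.
Hypotheses (hQ : Qforms d Q) (hQ' : Qforms d Q').
Hypotheses (g1 : \det gamma = 1) (cQ : concordant_gcd Q Q'').
Hypothesis hB : compose_B d Q Q'' B.
Hypotheses (B1 : B = qb Q + k * (2 * qa Q)) (B2 : B = qb Q'' + l * (2 * qa
  Q'')).

Let C := compose_form d Q Q'' B.
Let w := omega d C.
Let j := jfac gamma (omega d Q'').

Let hQ'' : Qforms d Q''.
Proof. exact: Qforms_act. Qed.

Let hC : Qforms d C.
Proof. exact: Qforms_compose. Qed.

Lemma omega_compose_l : omega d Q = (qa Q'')%:~R * w + k%:~R.
Proof.
have [a0 e0] : qa Q != 0 /\ qa Q'' != 0.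
  by rewrite -!(intr_eq0 algC) !(qa_neq0 (d := d)).
by rewrite /w /C /compose_form B1; case: Q a0 => a b c /= a0;
  apply: omega_mul_qa.
Qed.

Lemma omega_compose_r : omega d Q'' = (qa Q)%:~R * w + l%:~R.
Proof.
have [a0 e0] : qa Q != 0 /\ qa Q'' != 0.
  by rewrite -!(intr_eq0 algC) !(qa_neq0 (d := d)).
rewrite /w /C /compose_form B2 [qa Q * qa Q'']mulrC.
by case: Q'' e0 => a b c /= e0; apply: omega_mul_qa.
Qed.

(** Substituting omega_Q'' = a w + l in j gives the coordinates, and independence of (w, 1) makes
    them unique: 1 = u nu1 + v nu2 has exactly one solution. *)
Lemma jfac_compose (u v : int) :
  u%:~R * w + v%:~R = j <->
  u = gamma 1 0 * qa Q /\ v = gamma 1 1 + gamma 1 0 * l.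
Proof.
have jE : j = (gamma 1 0 * qa Q)%:~R * w + (gamma 1 1 + gamma 1 0 * l)%:~R.
  by rewrite /j /jfac omega_compose_r !(rmorphD, rmorphM) /=; ring.
split=> [e | [-> ->] //].
have [] : u - gamma 1 0 * qa Q = 0 /\ v - (gamma 1 1 + gamma 1 0 * l) = 0.
  apply: (omega_indep hC); rewrite 2!rmorphB /=.
  rewrite [LHS](_ : _ = u%:~R * w + v%:~R
    - ((gamma 1 0 * qa Q)%:~R * w + (gamma 1 1 + gamma 1 0 * l)%:~R));
      last by rewrite -/w; ring.
  by rewrite e -jE subrr.
by move=> /eqP; rewrite subr_eq0 => /eqP-> /eqP; rewrite subr_eq0 => /eqP->.
Qed.

Lemma lattice_mul_compose :
  ideal_mul (lattice (omega d Q) 1) (lattice (omega d Q') 1) =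
  lattice (w / j) (1 / j).
Proof.
have [x [y [z e1]]] := compose_B_coprime hQ hQ'' cQ hB.
have -> : lattice (omega d Q) 1 = lattice ((qa Q'')%:~R * w) 1.
  rewrite omega_compose_l; apply: lattice_eq.
  - by exists 1, k; ring.
  - by exists 0, 1; ring.
  - by exists 1, (- k); rewrite rmorphN; ring.
  - by exists 0, 1; ring.
rewrite (lattice_act hQ' g1) -/Q'' -/j.
have -> : lattice (omega d Q'' / j) (1 / j) = lattice ((qa Q)%:~R * w * j^-1)
  j^-1.
  rewrite omega_compose_r mul1r; apply: lattice_eq.
  - by exists 1, l; ring.
  - by exists 0, 1; ring.
  - by exists 1, (- l); rewrite rmorphN; ring.
  - by exists 0, 1; ring.
by rewrite mul1r; apply: lattice_mul_concordant e1; apply: omega_root hC.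
Qed.

(* The value of the composed form at (v, -u) is a a'' N(j), and N(j) = a'/a''. *)
Lemma compose_form_value :
  let u := gamma 1 0 * qa Q in let v := gamma 1 1 + gamma 1 0 * l in
  qa C * v ^+ 2 - qb C * u * v + qc C * u ^+ 2 = qa Q * qa Q'.
Proof.
have Dg := compose_qcr hQ'' hB B2.
move=> u v; rewrite -[in RHS](bqf_actK Q' g1) qa_act_invmx // -/Q'' Dg -/C.
have aC : qa C = qa Q * qa Q'' by [].
have bC : qb C = qb Q'' + l * (2 * qa Q'') by [].
by rewrite aC bC /u /v; ring.
Qed.

End Product.

(* The composition law in the group of form classes *)
Local Close Scope classical_set_scope.

Theorem mainTheorem4 (K : set algC) (dK : int) (n : set algC) (N : nat)
    (Q Q' : bqf)
    (hK : imaginary_quadratic K) (hd : field_disc K dK)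
    (hn : nonzero_ideal K n) (hN : least_pos_int n N)
    (hQ : QNforms N dK Q) (hQ' : QNforms N dK Q') :
  (exists gamma : 'M[int]_2,
     \det gamma = 1 /\ concordant_gcd Q (bqf_act Q' gamma)) /\
  (forall gamma : 'M[int]_2,
     let Q'' := bqf_act Q' gamma in
     \det gamma = 1 -> concordant_gcd Q Q'' ->
     [/\ exists B : int, compose_B dK Q Q'' B,
         forall B B' : int,
           compose_B dK Q Q'' B -> compose_B dK Q Q'' B' ->
           (B = B' %[mod 2 * qa Q * qa Q''])%Z
       & forall B : int, compose_B dK Q Q'' B ->
         let j := jfac gamma (omega dK Q'') in
         let nu1 : algC := (- B%:~R + sqrtd dK) /
                           (2 * (qa Q)%:~R * (qa Q'')%:~R * j) in
         let nu2 : algC := 1 / j in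
         (exists u v : int, 1 = u%:~R * nu1 + v%:~R * nu2) /\
         (forall u v : int, 1 = u%:~R * nu1 + v%:~R * nu2 ->
            let good_sigma (sigma : 'M[int]_2) :=
              [/\ \det sigma = 1, (sigma 1%R 0%R = u %[mod N])%Z
                & (sigma 1%R 1%R = v %[mod N])%Z] in
            (exists sigma, good_sigma sigma) /\
            (forall sigma, good_sigma sigma ->
               let R := bqf_act (compose_form dK Q Q'' B) (invmx sigma) in
               QNforms N dK R /\
               form_class_mul K n N dK (form_class K n N dK Q)
                                       (form_class K n N dK Q')
               = form_class K n N dK R))]).
Proof.
have subK := imaginary_quadratic_subfield hK.
have [N0 nN _] := hN; have [fQ cNa] := hQ; have [fQ' cNa'] := hQ'.
split; first exact: exists_concordant fQ fQ'.
move=> gamma Q'' g1 cQ; have fQ'' : Qforms dK Q'' by apply: Qforms_act.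
split; first exact: compose_B_exists cQ.
  by move=> B B'; apply: compose_B_unique.
move=> B hB j; have [/eqz_modP[k B1] /eqz_modP[l B2] _] := hB.
set C := compose_form dK Q Q'' B; pose w := omega dK C.
have fC : Qforms dK C by apply: Qforms_compose.
have j0 : j != 0 by apply: jfac_neq0.
move=> nu1 nu2.
have nu1E : nu1 = w / j.
  rewrite /nu1 -[w]/((- B%:~R + sqrtd dK) / (2 * (qa Q * qa Q'')%:~R)).
  by rewrite intrM !invfM !mulrA.
have uvP (u v : int) : 1 = u%:~R * nu1 + v%:~R * nu2 <->
    u = gamma 1 0 * qa Q /\ v = gamma 1 1 + gamma 1 0 * l.
  rewrite -(jfac_compose fQ fQ' g1 hB B2 u v) -/C -/w -/j.
  have -> : u%:~R * nu1 + v%:~R * nu2 = (u%:~R * w + v%:~R) / j.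
    by rewrite nu1E /nu2; ring.
  split=> [e | ->]; last by rewrite divff.
  by rewrite -[LHS](divfK j0) -e mul1r.
split; first by exists (gamma 1 0 * qa Q), (gamma 1 1 + gamma 1 0 * l);
  apply/uvP.
move=> u v /uvP[uE vE] good_sigma.
have [[x y] /= e1] := coprimezP _ _ cNa.
split.
  apply: lift_bottom_row => //; apply/gcdz3_eq1P.
  (* Let (p, q) and (r, s) be the rows of gamma. Then det gamma = 1 reads p v - (p l + q) r = 1, and
     r = y u + r x N because u = r a and x N + y a = 1. *)
  exists (- (gamma 0 0 * l + gamma 0 1) * y), (gamma 0 0),
    (- (gamma 0 0 * l + gamma 0 1) * gamma 1 0 * x).
  rewrite uE vE; move: g1; rewrite det_mx2 => g1; rewrite -[RHS]g1.
  rewrite [LHS](_ : _ = gamma 0 0 * (gamma 1 1 + gamma 1 0 * l)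
    - (gamma 0 0 * l + gamma 0 1) * gamma 1 0 * (x * N + y * qa Q));
      last by ring.
  by rewrite e1; ring.
move=> sigma [s1 /eqz_modP[su Du] /eqz_modP[sv Dv]]; set R := bqf_act _ _.
have fR : Qforms dK R by apply: Qforms_act => //; apply: det_invmx1.
have hR : QNforms N dK R.
  split=> //; have : coprimez N (qa Q * qa Q') by rewrite coprimezMr cNa.
  rewrite -(compose_form_value fQ' g1 hB B2) -/C -uE -vE.
  rewrite qa_act_invmx //.
  have shift (t x0 : int) : coprimez N x0 -> coprimez N (t * N + x0).
    by rewrite /coprimez gcdzMDl.
  (* The cofactor of N in the change of the value at (v, -u) when (u, v) becomes the bottom row (u +
     su N, v + sv N) of sigma. *)
  move/(shift (qa C * (2 * v * sv + sv ^+ 2 * N)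
    - qb C * (u * sv + v * su + su * sv * N) + qc C * (2 * u * su + su ^+ 2 *
      N))).
  by apply: etrans; rewrite Du Dv; congr (coprimez _ _); ring.
split=> //.
have RC : bqf_act R sigma = C by apply: bqf_actVK.
set js := jfac sigma w.
have js0 : js != 0 by apply: jfac_neq0.
have LR : lattice (omega dK R) 1 = lattice (w / js) (1 / js).
  by rewrite (lattice_act fR s1) RC.
have iQ := form_lattice_I_K subK hd hn nN hQ.
have iQ' := form_lattice_I_K subK hd hn nN hQ'.
have iR := form_lattice_I_K subK hd hn nN hR.
have LP : ideal_mul (lattice (omega dK Q) 1) (lattice (omega dK Q') 1) =
    lattice (w / j) (1 / j) := lattice_mul_compose fQ fQ' g1 cQ hB B1 B2.
have a0 := qa_neq0 fQ; have a'0 := qa_neq0 fQ'.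
pose mu := js / j.
have OKP t : lattice (w / j) (1 / j) t -> OK K ((qa Q)%:~R * (qa Q')%:~R * t).
  rewrite -LP; move: t; apply: (ideal_mul_ind
    (C := fun t => OK K ((qa Q)%:~R * (qa Q')%:~R * t))).
  - by rewrite mulr0; apply: OK0.
  - by move=> t t' Ot Ot'; rewrite mulrDr; apply: OKD.
  - by move=> t t' Lt Lt'; rewrite mulrACA; apply: OKM => //;
    apply: (form_lattice_OK subK hd).
have Pmu : P_K1 K n (principal K mu).
  exists mu => //; split.
  - apply: (subfield_setM subK); [|apply: (subfield_setV subK)];
    apply: (jfac_in_K subK).
      exact: omega_in_K fC.
    exact: omega_in_K fQ''.
  - by rewrite mulf_neq0 ?invr_eq0.
  exists ((qa Q)%:~R * (qa Q')%:~R * mu), ((qa Q)%:~R * (qa Q')%:~R); split;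
    split.
  - apply: OKP; exists (sigma 1 0), (sigma 1 1).
    by rewrite /mu /js /jfac; ring.
  - by apply: OKM => //; apply: OK_int.
  - exact: mulf_neq0.
  - by rewrite -rmorphM; apply: (comaximal_int subK hn nN);
    rewrite coprimezMr cNa.
  (* As j = u w + v, one has mu - 1 = N (su w + sv) / j, and [OKP] makes a a' (su w + sv) / j
     integral. *)
  - have -> : (qa Q)%:~R * (qa Q')%:~R * mu - (qa Q)%:~R * (qa Q')%:~R
      = (qa Q)%:~R * (qa Q')%:~R * (su%:~R * (w / j) + sv%:~R * (1 / j)) * N%:R.
      have jE : u%:~R * w + v%:~R = j by apply/(jfac_compose fQ fQ' g1 hB B2).
      have muE : mu - 1 = (js - (u%:~R * w + v%:~R)) / j by rewrite jE mulrBl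
        divff.
      rewrite -[X in _ - X]mulr1 -mulrBr muE /js /jfac Du Dv !(rmorphD,
        rmorphM) /=.
      by ring.
    by apply: (nonzero_idealM hn) => //; apply: OKP; exists su, sv.
  - by rewrite [RHS]mulrC mulKf // mulf_neq0.
have ray : ray_mul (form_ray_class K n dK Q) (form_ray_class K n dK Q') =
    form_ray_class K n dK R.
  rewrite /form_ray_class ray_mul_class // LP.
  rewrite -[RHS](ray_class_mulP subK hn _ Pmu); last by case: iR => [[]].
  rewrite ideal_mul_principal //; last by case: iR => [[]].
  rewrite LR -lattice_scale /mu; congr ray_class; congr lattice.
    by field; rewrite j0 js0.
  by field; rewrite j0 js0.
(* All members of a form class share one ray class, so any representatives give the ray class of R;
   conversely Q and Q' represent their own classes. *)
rewrite eqEsubset; split=> S [hS].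
  move=> [Q1 [Q2 [[_ e2] [_ e3] eS]]]; split=> //.
  by rewrite /form_equiv -ray eS e2 e3.
by rewrite /form_equiv => eS; split=> //; exists Q, Q'; rewrite ray -eS.
Qed.
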